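(* There exist absolute (numerical) constants $c,C,p>0$ such that the following holds. Let $n,K\ge 1$ be integers, let $f_1,\dots,f_n:\mathbb{R}^{d_x}\times\mathbb{R}^{d_y}\to\mathbb{R}$ and $f=\frac1n\sum_{i=1}^n f_i$. Suppose: (a) every $f_i$ is differentiable and $\nabla f_i$ is $L$-Lipschitz, where $L>0$; (b) there are $A,B\ge 0$ with $\frac1n\sum_{i=1}^n\|\nabla_j f_i(z)-\nabla_j f(z)\|^2\le A\|\nabla_j f(z)\|^2+B$ for all $z\in\mathbb{R}^{d_x}\times\mathbb{R}^{d_y}$ and $j\in\{1,2\}$; (c) $\Phi(x):=\max_{y'} f(x;y')$ is well-defined for every $x$, the set $\operatorname{argmax}_{y'}f(x;y')$ is non-empty and closed for every $x$, and $\Phi$ is bounded below; (d) there is $\mu_2>0$ with $\|\nabla_2 f(x;y)\|^2\ge 2\mu_2(\Phi(x)-f(x;y))$ for all $(x;y)$; (e) $\Phi^*:=\min_x\Phi(x)$ is well-defined and there is $\mu_1>0$ with $\|\nabla\Phi(x)\|^2\ge 2\mu_1(\Phi(x)-\Phi^* )$ for all $x$. Let $\kappa_1=L/\mu_1$, $\kappa_2=L/\mu_2$, $\lambda=4$, and let $r\ge14\kappa_2^2$. Put $$\Lambda=\frac{V_\lambda(z_0^1)\,\mu_1 nK^2}{8c^3\kappa_1^2r^3B},\qquad \beta=\min\left\{\frac{1}{6L\sqrt{n(n+A)}},\ \frac{2r}{\mu_1nK}\max\{1,\log\Lambda\}\right\},\qquad \alpha=\frac{\beta}{r}.$$ Then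 both simSGDA-RR and altSGDA-RR, started at $z_0^1$ and run for $K$ epochs with step sizes $\alpha,\beta$, satisfy $$\mathbb{E}[V_\lambda(z_0^{K+1})]\le C\,V_\lambda(z_0^1)\exp\left(-\frac{K}{12\kappa_1r\sqrt{1+\frac An}}\right)+C\,\frac{\kappa_1^2r^3B}{\mu_1nK^2}\,\bigl(\max\{1,\log\Lambda\}\bigr)^p .$$
   Context: Notation: $z=(x;y)$ with $x\in\mathbb{R}^{d_x}$, $y\in\mathbb{R}^{d_y}$; $\nabla_1,\nabla_2$ are the gradients with respect to $x$ and $y$; $\|\cdot\|$ is the Euclidean norm. Under (a), (c), (d) the function $\Phi$ is differentiable. The potential function is $V_\lambda(x;y)=\lambda(\Phi(x)-\Phi^* )+(\Phi(x)-f(x;y))$. Algorithm (SGDA with random reshuffling): the initial point $(x_0^1;y_0^1)$ is given. In each epoch $k=1,\dots,K$, a permutation $\sigma_k$ of $\{1,\dots,n\}$ is sampled uniformly at random (independently over epochs). For $i=1,\dots,n$: $x_i^k=x_{i-1}^k-\alpha\nabla_1 f_{\sigma_k(i)}(x_{i-1}^k;y_{i-1}^k)$, and $y_i^k=y_{i-1}^k+\beta\nabla_2 f_{\sigma_k(i)}(x';y_{i-1}^k)$ with $x'=x_{i-1}^k$ for simSGDA-RR and $x'=x_i^k$ for altSGDA-RR. Then $(x_0^{k+1};y_0^{k+1})=(x_n^k;y_n^k)$. $\mathbb{E}$ is over the permutations. Conventions: if $B=0$, then the second argument of the minimum defining $\beta$ is $+\infty$ and the second term of the bound is $0$; $\log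 0=-\infty$.
   Formalization: The formal theorem additionally assumes κ₂ ≥ 1 when f does not depend on y, and κ₁ ≥ 1 when Φ is constant; in these degenerate cases μ₂ (resp. μ₁) could otherwise be arbitrarily large and the stated bound fails, e.g. for f=x²/2 or f=−y²/2. *)

(* Defs.v *)
From HB Require Import structures.
From mathcomp Require Import all_boot all_order all_algebra.
From mathcomp Require Import perm.
From mathcomp Require Import all_classical all_reals all_analysis.

Set Implicit Arguments.
Unset Strict Implicit.
Unset Printing Implicit Defensive.

Import Order.TTheory GRing.Theory Num.Theory.
Import numFieldNormedType.Exports.

Local Open Scope classical_set_scope.
Local Open Scope ring_scope.

(* The library norm on ['rV[R]_d] and on products is the sup norm; it induces
   the usual topology and differentiability, but not the Euclidean norm. *)
Definition enorm (R : realType) (d : nat) (v : 'rV[R]_d) : R :=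
  Num.sqrt (\sum_(i < d) v 0 i ^+ 2).

Definition enorm2 (R : realType) (dx dy : nat)
    (z : 'rV[R]_dx * 'rV[R]_dy) : R :=
  Num.sqrt (enorm z.1 ^+ 2 + enorm z.2 ^+ 2).

Definition grad (R : realType) (d : nat) (g : 'rV[R]_d -> R) (x : 'rV[R]_d) :
    'rV[R]_d :=
  \row_(i < d) 'D_(delta_mx 0 i) g x.

Section TwoBlocks.
Context {R : realType} {dx dy : nat}.
Local Notation Z := ('rV[R]_dx * 'rV[R]_dy)%type.

Definition grad1 (g : Z -> R) (z : Z) : 'rV[R]_dx :=
  grad (fun x => g (x, z.2)) z.1.

Definition grad2 (g : Z -> R) (z : Z) : 'rV[R]_dy :=
  grad (fun y => g (z.1, y)) z.2.

Definition grad12 (g : Z -> R) (z : Z) : Z := (grad1 g z, grad2 g z).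

Definition favg (n : nat) (fs : 'I_n -> Z -> R) (z : Z) : R :=
  n%:R^-1 * \sum_(i < n) fs i z.

Definition argmax2 (f : Z -> R) (x : 'rV[R]_dx) : set 'rV[R]_dy :=
  [set y | forall y', f (x, y') <= f (x, y)].

Definition potential (lam : R) (f : Z -> R) (Phi : 'rV[R]_dx -> R)
    (Phimin : R) (z : Z) : R :=
  lam * (Phi z.1 - Phimin) + (Phi z.1 - f z).

End TwoBlocks.

Definition is_max (R : realType) (A : set R) (m : R) : Prop :=
  A m /\ ubound A m.

Definition is_min (R : realType) (A : set R) (m : R) : Prop :=
  A m /\ lbound A m.

Variant sgda_variant := simSGDA | altSGDA.

Section SGDA.
Context {R : realType} {dx dy : nat}.
Local Notation Z := ('rV[R]_dx * 'rV[R]_dy)%type.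

Definition sgda_step (v : sgda_variant) (alpha beta : R) (g : Z -> R)
    (z : Z) : Z :=
  let x1 := z.1 - alpha *: grad1 g z in
  let x' := match v with simSGDA => z.1 | altSGDA => x1 end in
  (x1, z.2 + beta *: grad2 g (x', z.2)).

Definition sgda_epoch (v : sgda_variant) (alpha beta : R) (n : nat)
    (fs : 'I_n -> Z -> R) (z : Z) (sigma : 'S_n) : Z :=
  foldl (fun w i => sgda_step v alpha beta (fs (sigma i)) w) z (enum 'I_n).

(* The [k]-th entry of [sigmas] is the permutation used in epoch [k]; the
   result is the iterate after the last epoch. *)
Definition sgda_rr (v : sgda_variant) (alpha beta : R) (n K : nat)
    (fs : 'I_n -> Z -> R) (z : Z) (sigmas : K.-tuple 'S_n) : Z :=
  foldl (sgda_epoch v alpha beta fs) z sigmas.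

End SGDA.

(* Independent uniform permutations over [K] epochs are a uniformly distributed
   element of [K.-tuple 'S_n]. *)
Definition expect_unif (R : realType) (T : finType) (g : T -> R) : R :=
  (\sum_(t : T) g t) / #|T|%:R.

(* [max {1, log t}] for [0 <= t]. The convention [log 0 = -oo] gives the value
   1 at 0; so does [ln 0 = 0]. *)
Definition log_factor (R : realType) (t : R) : R := Num.max 1 (ln t).

(* Only meaningful for [B <> 0]; the case [B = 0] is treated in [beta_step]. *)
Definition Lambda (R : realType) (c V0 mu1 kappa1 r B : R) (n K : nat) : R :=
  (V0 * mu1 * n%:R * K%:R ^+ 2) / (8 * c ^+ 3 * kappa1 ^+ 2 * r ^+ 3 * B).

(* For [B = 0] the second argument of the minimum is [+oo]. *)
Definition beta_step (R : realType) (L A B mu1 r Lam : R) (n K : nat) : R :=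
  let b1 := 1 / (6 * L * Num.sqrt (n%:R * (n%:R + A))) in
  let b2 := 2 * r / (mu1 * n%:R * K%:R) * log_factor Lam in
  if B == 0 then b1 else Num.min b1 b2.

(* Main.v *)
Require Import Defs.
From mathcomp Require Import all_boot all_order all_algebra.
From mathcomp Require Import perm.
From mathcomp Require Import all_classical all_reals all_analysis.
From mathcomp Require Import ring lra.
Import Order.TTheory GRing.Theory Num.Theory.
Import numFieldNormedType.Exports.

Set Implicit Arguments.
Unset Strict Implicit.
Unset Printing Implicit Defensive.

Local Open Scope classical_set_scope.
Local Open Scope ring_scope.

(** Write [a = n * alpha] and [b = n * beta]. An epoch moves along the full
    gradients [(- a * grad1 f, b * grad2 f)] taken at its starting point, up to
    errors caused by the drift of the iterate inside the epoch
    ([epoch_as_inexact_step]). The proof has three ingredients.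

    Geometry. The PL inequality in [y] makes [Phi] differentiable with
    [grad Phi x = grad1 f (x, y)] at any maximizer [y], and smooth from above
    with constant [LPhi = L + L^2 / mu2] ([Phi_ub], [grad_Phi]). Since
    [Phi - f (-, y)] is nonnegative and smooth from above, the mismatch
    [|grad Phi x - grad1 f (x, y)|^2] is at most a constant times [LPhi] times
    the gap [Phi x - f (x, y)] ([grad_error_le]), which the PL inequality turns
    into a multiple of [kappa2^2 * |grad2 f|^2]. As [a = b / r] with
    [r >= 14 * kappa2^2], the ascent in [y] pays for this mismatch, and the
    potential [4 * (Phi - Phimin) + (Phi - f)] decreases at each epoch by
    [a * |grad Phi|^2] and a multiple of [b * |grad2 f|^2], up to the errors
    ([potential_step]).

    Sampling. The drift is controlled by partial sums of the component gradients
    at the starting point ([drift_le]). Draws without replacement are negatively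
    correlated, so a partial sum of [i] components has mean square at most
    [i^2 |g|^2 + i * variance] ([expect_nsq_partial_sum]): the noise enters one
    epoch only as [L^2 b^3 B / n], while the rest is absorbed by the decrease
    because [L b sqrt (1 + A / n) <= 1 / 6]. With both PL inequalities this
    gives a contraction by [1 - x], [x = a * mu1 / 2], plus that noise
    ([expect_potential_epoch]).

    Tuning. Over [K] epochs the noise adds up to [L^2 b^3 B / (n x)]; when
    [B > 0], the choice of [beta] gives [b <= 2 r log_factor / (mu1 K)], so this
    sum is at most [kappa1^2 r^3 B log_factor^2 / (mu1 n K^2)] times a constant.
    The initial potential is multiplied by [exp (- K x)]: this is the stated exponential
    when [beta] is the first term of the minimum, and [exp (- log_factor) <=
    1 / Lambda] otherwise, which brings the initial potential down to the noise
    level. The constants are [c = 1], [C = 40], [p = 2]. *)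

(** * Euclidean inner product and gradients *)

Section InnerProduct.
Context {R : realType} {d : nat}.
Implicit Types u v w : 'rV[R]_d.

Definition dot u v : R := \sum_(i < d) u 0 i * v 0 i.
(** The squared Euclidean norm; working with squares throughout avoids square
    roots. *)
Definition nsq v : R := dot v v.

Lemma dotC u v : dot u v = dot v u.
Proof. by apply: eq_bigr => i _; rewrite mulrC. Qed.

Lemma dotDl u v w : dot (u + v) w = dot u w + dot v w.
Proof. by rewrite -big_split; apply: eq_bigr => i _; rewrite mxE mulrDl. Qed.

Lemma dotZl a u v : dot (a *: u) v = a * dot u v.
Proof. by rewrite mulr_sumr; apply: eq_bigr => i _; rewrite mxE mulrA. Qed.

Lemma dotNl u v : dot (- u) v = - dot u v.
Proof. by rewrite -scaleN1r dotZl mulN1r. Qed.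

Lemma dotBl u v w : dot (u - v) w = dot u w - dot v w.
Proof. by rewrite dotDl dotNl. Qed.

Lemma dotDr u v w : dot u (v + w) = dot u v + dot u w.
Proof. by rewrite dotC dotDl !(dotC u). Qed.

Lemma dotZr a u v : dot u (a *: v) = a * dot u v.
Proof. by rewrite dotC dotZl dotC. Qed.

Lemma dotNr u v : dot u (- v) = - dot u v.
Proof. by rewrite dotC dotNl dotC. Qed.

Lemma dot0l v : dot 0 v = 0.
Proof. by rewrite /dot big1 // => i _; rewrite mxE mul0r. Qed.

Lemma dot0r v : dot v 0 = 0.
Proof. by rewrite dotC dot0l. Qed.

Lemma dot_suml (I : Type) (r : seq I) (P : pred I) (F : I -> 'rV[R]_d) v :
  dot (\sum_(i <- r | P i) F i) v = \sum_(i <- r | P i) dot (F i) v.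
Proof. exact: (big_morph (dot ^~ v) (fun u w => dotDl u w v) (dot0l v)). Qed.

Lemma dot_sumr (I : Type) (r : seq I) (P : pred I) (F : I -> 'rV[R]_d) v :
  dot v (\sum_(i <- r | P i) F i) = \sum_(i <- r | P i) dot v (F i).
Proof. by rewrite dotC dot_suml; apply: eq_bigr => i _; rewrite dotC. Qed.

Lemma dot_delta v i : dot v (delta_mx 0 i) = v 0 i.
Proof.
rewrite /dot (bigD1 i) //= big1 ?addr0; first by rewrite mxE !eqxx mulr1.
by move=> j ji; rewrite mxE (negPf ji) mulr0.
Qed.

Lemma nsq_ge0 v : 0 <= nsq v.
Proof. by apply: sumr_ge0 => i _; rewrite -expr2 sqr_ge0. Qed.

Lemma nsq0 : nsq 0 = 0.
Proof. exact: dot0l. Qed.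

Lemma nsq_eq0 v : nsq v = 0 -> v = 0.
Proof.
move=> v0; apply/rowP => i; rewrite mxE; apply/eqP; rewrite -sqrf_eq0 expr2.
apply/eqP; apply: (psumr_eq0P _ v0) => // j _.
by rewrite -expr2 sqr_ge0.
Qed.

Lemma nsqZ a v : nsq (a *: v) = a ^+ 2 * nsq v.
Proof. by rewrite /nsq dotZl dotZr mulrA expr2. Qed.

Lemma nsqN v : nsq (- v) = nsq v.
Proof. by rewrite -scaleN1r nsqZ sqrrN expr1n mul1r. Qed.

Lemma nsqD u v : nsq (u + v) = nsq u + 2 * dot u v + nsq v.
Proof. by rewrite /nsq dotDl !dotDr (dotC v u); ring. Qed.

Lemma nsqB u v : nsq (u - v) = nsq u - 2 * dot u v + nsq v.
Proof. by rewrite nsqD dotNr nsqN mulrN. Qed.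

Lemma enorm_sqr v : enorm v ^+ 2 = nsq v.
Proof.
rewrite /enorm sqr_sqrtr; first by apply: eq_bigr => i _; rewrite expr2.
by apply: sumr_ge0 => i _; rewrite sqr_ge0.
Qed.

Lemma nsqD_le2 u v : nsq (u + v) <= 2 * nsq u + 2 * nsq v.
Proof. by have := nsq_ge0 (u - v); rewrite nsqB nsqD; lra. Qed.

(** Cauchy--Schwarz in the square-root-free form [(sum v_i)^2 <= n sum v_i^2],
    which follows from the nonnegativity of the sum of all squared pairwise
    differences. *)
Lemma nsq_sum_le (I : finType) (P : pred I) (F : I -> 'rV[R]_d) :
  nsq (\sum_(i | P i) F i) <= #|P|%:R * \sum_(i | P i) nsq (F i).
Proof.
have : 0 <= \sum_(i | P i) \sum_(j | P j) nsq (F i - F j).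
  by apply: sumr_ge0 => i _; apply: sumr_ge0 => j _; exact: nsq_ge0.
have -> : \sum_(i | P i) \sum_(j | P j) nsq (F i - F j) =
    2 * (#|P|%:R * \sum_(i | P i) nsq (F i)) - 2 * nsq (\sum_(i | P i) F i).
  under eq_bigr => i _ do under eq_bigr => j _ do rewrite nsqB.
  under eq_bigr => i _ do rewrite !big_split /= sumr_const sumrN -mulr_sumr
    -dot_sumr.
  rewrite !big_split /= sumrN -mulr_sumr -dot_suml sumr_const -/(nsq _).
  rewrite sumrMnl -(mulr_natl (\sum_(i | P i) nsq (F i))); ring.
by lra.
Qed.

Lemma nsq_mean_le (n : nat) (F : 'I_n -> 'rV[R]_d) : (0 < n)%N ->
  nsq (n%:R^-1 *: \sum_i F i) <= n%:R^-1 * \sum_i nsq (F i).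
Proof.
move=> n0; have nR : 0 < n%:R :> R by rewrite ltr0n.
rewrite nsqZ expr2 -mulrA ler_pM2l ?invr_gt0 // ler_pdivrMl //.
by have := nsq_sum_le xpredT F; rewrite card_ord.
Qed.

End InnerProduct.

(** Directional derivatives see a function only along a line; this transports
    them between a function of one block and the function of both blocks. *)
Lemma derive_congr (R : realType) (V W : normedModType R) (f : V -> R)
    (g : W -> R) (a v : V) (b w : W) :
  (forall t : R, f (t *: v + a) = g (t *: w + b)) -> f a = g b ->
  'D_v f a = 'D_w g b.
Proof.
move=> fg fgab; rewrite /derive.
suff -> : (fun h : R => h^-1 *: ((f \o shift a) (h *: v) - f a)) =
          (fun h : R => h^-1 *: ((g \o shift b) (h *: w) - g b)) by [].
by apply/funext => t /=; rewrite fg fgab.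
Qed.

Section Gradients.
Context {R : realType} {dx dy : nat}.
Local Notation Z := ('rV[R]_dx * 'rV[R]_dy)%type.
Implicit Types (g : Z -> R) (z w h : Z).

Definition nsq2 z := nsq z.1 + nsq z.2.

Lemma enorm2_sqr z : enorm2 z ^+ 2 = nsq2 z.
Proof. by rewrite /enorm2 !enorm_sqr sqr_sqrtr // addr_ge0 ?nsq_ge0. Qed.

Lemma grad1E g z i : grad1 g z 0 i = 'D_((delta_mx 0 i, 0) : Z) g z.
Proof.
rewrite /grad1 /grad mxE; apply: derive_congr => [t|]; last by case: z.
by congr g; apply/pair_equal_spec; rewrite /= scaler0 add0r.
Qed.

Lemma grad2E g z i : grad2 g z 0 i = 'D_((0, delta_mx 0 i) : Z) g z.
Proof.
rewrite /grad2 /grad mxE; apply: derive_congr => [t|]; last by case: z.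
by congr g; apply/pair_equal_spec; rewrite /= scaler0 add0r.
Qed.

Lemma derive_grad g z h : differentiable g z ->
  'D_h g z = dot (grad1 g z) h.1 + dot (grad2 g z) h.2.
Proof.
move=> dg; rewrite deriveE //.
have hE : h = \sum_(i < dx) (h.1 0 i *: ((delta_mx 0 i, 0) : Z)) +
              \sum_(i < dy) (h.2 0 i *: ((0, delta_mx 0 i) : Z)).
  have e1 (s : seq 'I_dx) : \sum_(i <- s) h.1 0 i *: ((delta_mx 0 i, 0) : Z) =
      (\sum_(i <- s) h.1 0 i *: delta_mx 0 i, 0).
    elim: s => [|i s IH]; rewrite ?big_nil // !big_cons IH.
    by apply/pair_equal_spec; rewrite /= scaler0 addr0.
  have e2 (s : seq 'I_dy) : \sum_(i <- s) h.2 0 i *: ((0, delta_mx 0 i) : Z) =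
      (0, \sum_(i <- s) h.2 0 i *: delta_mx 0 i).
    elim: s => [|i s IH]; rewrite ?big_nil // !big_cons IH.
    by apply/pair_equal_spec; rewrite /= scaler0 addr0.
  rewrite e1 e2 -!row_sum_delta; case: (h) => h1 h2.
  by apply/pair_equal_spec; rewrite /= addr0 add0r.
rewrite [X in 'd g z X]hE linearD !linear_sum /= /dot.
congr (_ + _); apply: eq_bigr => i _.
- by rewrite [LHS]linearZ /= -deriveE // -grad1E mulrC.
- by rewrite [LHS]linearZ /= -deriveE // -grad2E mulrC.
Qed.

End Gradients.

(** * The descent lemma *)

Section Smoothness.
Context {R : realType} {dx dy : nat}.
Local Notation Z := ('rV[R]_dx * 'rV[R]_dy)%type.
Context (L : R) (f : Z -> R).
Hypothesis L_gt0 : 0 < L.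
Hypothesis f_diff : forall z, differentiable f z.
Hypothesis f_lip : forall z w : Z,
  nsq (grad1 f z - grad1 f w) + nsq (grad2 f z - grad2 f w)
    <= L ^+ 2 * nsq2 (z - w).

Lemma line_is_derive (z h : Z) (t : R) :
  is_derive t 1 (fun s : R => f (z + s *: h))
    (dot (grad1 f (z + t *: h)) h.1 + dot (grad2 f (z + t *: h)) h.2).
Proof.
rewrite -derive_grad //.
have q : (fun k : R => k^-1 *: (((fun s : R => f (z + s *: h)) \o shift t)
     (k *: (1 : R)) - f (z + t *: h))) =
    (fun k => k^-1 *: ((f \o shift (z + t *: h)) (k *: h) - f (z + t *: h))).
  apply/funext => k /=; congr (_ *: (f _ - _)).
  by rewrite [k *: 1]mulr1 scalerDl addrCA.
apply: DeriveDef; first by rewrite /derivable q; exact: diff_derivable.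
by rewrite /derive q.
Qed.

(** The mean value theorem for [t |-> f (z + t h) - t s - t^2 M], where [s] is
    the slope at [0]; [M] is left free so that both signs of the quadratic
    remainder come from one statement. *)
Lemma line_mean_value (z h : Z) (M : R) :
  exists2 c : R, 0 < c < 1 &
  f (z + h) - f z - (dot (grad1 f z) h.1 + dot (grad2 f z) h.2) - M =
  dot (grad1 f (z + c *: h) - grad1 f z) h.1
  + dot (grad2 f (z + c *: h) - grad2 f z) h.2 - 2 * c * M.
Proof.
set s := dot (grad1 f z) h.1 + _.
pose psi (t : R) : R := f (z + t *: h) - (t * s + t ^+ 2 * M).
pose dpsi (t : R) : R :=
  (dot (grad1 f (z + t *: h)) h.1 + dot (grad2 f (z + t *: h)) h.2)
  - (s + 2 * t * M).
have dpsiP (t : R) : is_derive t 1 psi (dpsi t).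
  apply: is_deriveB; first exact: line_is_derive.
  apply: is_derive_eq; rewrite /GRing.scale /=.
  by ring.
have cpsi : {within `[0, 1], continuous psi}.
  apply: derivable_within_continuous => x _.
  by have := dpsiP x => /@ex_derive.
have [c c01 e] := MVT ltr01 (fun x _ => dpsiP x) cpsi.
exists c; first by move: c01; rewrite in_itv.
move: e; rewrite /psi /dpsi scale1r scale0r addr0 !dotBl /s => e; lra.
Qed.

(** Young's inequality with weight [c * L] on the gradient increment. *)
Lemma grad_increment_le (z h : Z) (c : R) : 0 < c ->
  `|dot (grad1 f (z + c *: h) - grad1 f z) h.1
    + dot (grad2 f (z + c *: h) - grad2 f z) h.2| <= c * L * nsq2 h.
Proof.
move=> c0; have := f_lip (z + c *: h) z.
have -> : z + c *: h - z = c *: h by rewrite addrC addKr.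
move: (grad1 f _ - _) (grad2 f _ - _) => p q.
rewrite /nsq2 /= !nsqZ -mulrDr => le.
have cL : 0 < c * L by rewrite mulr_gt0.
have nB :=
  addr_ge0 (nsq_ge0 (p - (c * L) *: h.1)) (nsq_ge0 (q - (c * L) *: h.2)).
have nD :=
  addr_ge0 (nsq_ge0 (p + (c * L) *: h.1)) (nsq_ge0 (q + (c * L) *: h.2)).
rewrite !nsqB !nsqZ !dotZr in nB; rewrite !nsqD !nsqZ !dotZr in nD.
rewrite mulrA -exprMn [L * c]mulrC in le.
rewrite ler_norml; apply/andP; split; rewrite -(ler_pM2l cL).
all: lra.
Qed.

(** The descent lemma: along a segment the gradient differs from its initial
    value by at most [c * L] times the displacement, and the mean value theorem
    turns this linear growth into the quadratic remainder. *)
Lemma smooth_remainder (z h : Z) :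
  `|f (z + h) - f z - (dot (grad1 f z) h.1 + dot (grad2 f z) h.2)|
    <= L / 2 * nsq2 h.
Proof.
rewrite ler_norml; apply/andP; split.
- have [c /andP[c0 c1] e] := line_mean_value z h (- (L / 2 * nsq2 h)).
  have /ler_normlP[] := grad_increment_le z h c0; lra.
- have [c /andP[c0 c1] e] := line_mean_value z h (L / 2 * nsq2 h).
  have /ler_normlP[] := grad_increment_le z h c0; lra.
Qed.

Lemma smooth_ub (z h : Z) :
  f (z + h) <= f z + (dot (grad1 f z) h.1 + dot (grad2 f z) h.2)
               + L / 2 * nsq2 h.
Proof. by have /ler_normlP[] := smooth_remainder z h; lra. Qed.

Lemma smooth_lb (z h : Z) :
  f z + (dot (grad1 f z) h.1 + dot (grad2 f z) h.2) - L / 2 * nsq2 h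
    <= f (z + h).
Proof. by have /ler_normlP[] := smooth_remainder z h; lra. Qed.

End Smoothness.

(** * The maximal value function *)

(** The difference quotient along the [i]-th axis is within [M * |k|] of
    [G 0 i]; this identifies the limits in the definition of [grad Phi]. *)
Lemma grad_of_quadratic_remainder (R : realType) (d : nat)
    (g : 'rV[R]_d -> R) (x G : 'rV[R]_d) (M : R) :
  (forall h, `|g (x + h) - g x - dot G h| <= M * nsq h) -> grad g x = G.
Proof.
move=> rem; apply/rowP => i; rewrite mxE.
apply: cvg_lim => //; apply/cvgrPdist_le => e e0.
have M1 : 0 < `|M| + 1 by rewrite ltr_wpDl.
have : \forall k \near (0 : R)^', `|k| < e / (`|M| + 1).
  by apply: dnbhs0_lt; rewrite divr_gt0.
have : \forall k \near (0 : R)^', k != 0.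
  exact: nbhs_dnbhs_neq.
apply: filterS2 => k k0 ke /=.
have := rem (k *: delta_mx 0 i).
rewrite nsqZ /nsq dot_delta mxE !eqxx mulr1 dotZr dot_delta => le.
have -> : G 0 i - k^-1 *: (g (k *: delta_mx 0 i + x) - g x) =
    - (k^-1 * (g (x + k *: delta_mx 0 i) - g x - k * G 0 i)).
  by rewrite [x + _]addrC /GRing.scale /=; field.
rewrite normrN normrM normfV ler_pdivrMl ?normr_gt0 //.
apply: (le_trans le); rewrite -(real_normK (num_real k)) expr2 mulrCA.
rewrite ler_wpM2l //; move: ke; rewrite ltr_pdivlMr // => ke.
apply: le_trans (ltW ke); rewrite mulrC ler_wpM2l //.
by apply: le_trans (ler_norm M) _; rewrite lerDl.
Qed.

Section PartialMax.
Context {R : realType} {dx dy : nat}.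
Local Notation Z := ('rV[R]_dx * 'rV[R]_dy)%type.
Context (L mu2 : R) (f : Z -> R) (Phi : 'rV[R]_dx -> R).
Hypothesis L_gt0 : 0 < L.
Hypothesis f_diff : forall z, differentiable f z.
Hypothesis f_lip : forall z w : Z,
  nsq (grad1 f z - grad1 f w) + nsq (grad2 f z - grad2 f w)
    <= L ^+ 2 * nsq2 (z - w).
Hypothesis Phi_max : forall x, is_max (range (fun y => f (x, y))) (Phi x).
Hypothesis mu2_gt0 : 0 < mu2.
Hypothesis PL2 : forall x y,
  2 * mu2 * (Phi x - f (x, y)) <= nsq (grad2 f (x, y)).

Lemma le_Phi x y : f (x, y) <= Phi x.
Proof. by have [_] := Phi_max x; apply; exists y. Qed.

Lemma Phi_attained x : exists y, f (x, y) = Phi x.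
Proof. by have [[y _ <-] _] := Phi_max x; exists y. Qed.

(** One gradient ascent step of length [1 / L] in [y] cannot exceed the
    maximum. *)
Lemma nsq_grad2_le x y : nsq (grad2 f (x, y)) <= 2 * L * (Phi x - f (x, y)).
Proof.
have := smooth_lb L_gt0 f_diff f_lip (x, y) (0, L^-1 *: grad2 f (x, y)).
rewrite /nsq2 /= dot0r nsq0 !add0r dotZr nsqZ -/(nsq _) => lb.
have := le_trans lb (le_Phi (x + 0) _); rewrite addr0 => {}lb.
have Lne : L != 0 by rewrite gt_eqF.
have e : L^-1 * nsq (grad2 f (x, y))
    - L / 2 * (L^-1 ^+ 2 * nsq (grad2 f (x, y))) =
    nsq (grad2 f (x, y)) / (2 * L) by field.
by rewrite -ler_pdivrMl ?mulr_gt0 // mulrC -e; lra.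
Qed.

(** The gap must be positive at some point: when [f] does not depend on [y],
    every [mu2] satisfies the PL inequality. *)
Lemma mu2_le_L x y : f (x, y) < Phi x -> mu2 <= L.
Proof.
move=> lt; have := le_trans (PL2 x y) (nsq_grad2_le x y).
by rewrite -!mulrA ler_pM2l // ler_pM2r // subr_gt0.
Qed.

Lemma grad2_argmax x y : f (x, y) = Phi x -> nsq (grad2 f (x, y)) = 0.
Proof.
move=> e; apply/eqP; rewrite eq_le nsq_ge0 andbT.
by have := nsq_grad2_le x y; rewrite e subrr mulr0.
Qed.

Definition LPhi : R := L + L ^+ 2 / mu2.

Lemma LPhi_ge : L <= LPhi.
Proof. by rewrite lerDl divr_ge0 ?sqr_ge0 ?ltW. Qed.

(** Moving [x] by [h] perturbs [grad2 f] at the old maximizer by at most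
    [L * |h|], so by the PL inequality that point stays within
    [L ^+ 2 * |h| ^+ 2 / (2 * mu2)] of the new maximum, and [Phi]
    inherits the quadratic upper model of [f (-, y)]. *)
Lemma Phi_ub x y h : f (x, y) = Phi x ->
  Phi (x + h) <= Phi x + dot (grad1 f (x, y)) h + LPhi / 2 * nsq h.
Proof.
move=> e; have := smooth_ub L_gt0 f_diff f_lip (x, y) (h, 0).
rewrite /nsq2 /= dot0r nsq0 !addr0 e.
have -> : (x, y) + (h, 0) = (x + h, y).
  by apply/pair_equal_spec; rewrite /= addr0.
move=> ub; have := f_lip (x + h, y) (x, y).
have -> : (x + h, y) - (x, y) = (h, 0).
  by apply/pair_equal_spec; rewrite /= [x + h]addrC addrK subrr.
rewrite /nsq2 /= nsq0 addr0 => lip.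
have g0 : grad2 f (x, y) = 0.
  by apply: nsq_eq0; exact: grad2_argmax.
rewrite g0 subr0 in lip.
have gap : Phi (x + h) - f (x + h, y) <= L ^+ 2 * nsq h / (2 * mu2).
  rewrite ler_pdivlMr ?mulr_gt0 // mulrC.
  apply: le_trans (PL2 _ _) _; apply: le_trans _ lip.
  by rewrite lerDr nsq_ge0.
have e2 : LPhi / 2 * nsq h = L / 2 * nsq h + L ^+ 2 * nsq h / (2 * mu2).
  by rewrite /LPhi; field; rewrite gt_eqF.
lra.
Qed.

Lemma Phi_lb x y h : f (x, y) = Phi x ->
  Phi x + dot (grad1 f (x, y)) h - L / 2 * nsq h <= Phi (x + h).
Proof.
move=> e; have := smooth_lb L_gt0 f_diff f_lip (x, y) (h, 0).
rewrite /nsq2 /= dot0r nsq0 !addr0 e => lb; apply: le_trans lb _.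
exact: (le_Phi (x + h) (y + 0)).
Qed.

Lemma grad_Phi x y : f (x, y) = Phi x -> grad Phi x = grad1 f (x, y).
Proof.
move=> e; apply: (@grad_of_quadratic_remainder _ _ _ _ _ (LPhi / 2)) => h.
have := Phi_ub h e; have := Phi_lb h e.
have le : L / 2 * nsq h <= LPhi / 2 * nsq h.
  by rewrite ler_wpM2r ?nsq_ge0 // ler_wpM2r ?invr_ge0 // LPhi_ge.
by rewrite ler_norml => lb ub; apply/andP; split; lra.
Qed.

Lemma Phi_descent x h :
  Phi (x + h) <= Phi x + dot (grad Phi x) h + LPhi / 2 * nsq h.
Proof.
by have [y e] := Phi_attained x; rewrite (grad_Phi e); exact: Phi_ub.
Qed.

(** [Phi - f (-, y)] is nonnegative, and smooth from above with constant
    [LPhi + L]; a gradient step of that length cannot make it negative. This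
    controls the gradient error by the gap without measuring the distance from
    [y] to the argmax. *)
Lemma grad_error_le x y :
  nsq (grad Phi x - grad1 f (x, y)) <= 2 * (LPhi + L) * (Phi x - f (x, y)).
Proof.
set d := grad Phi x - _; set M := LPhi + L.
have M0 : 0 < M by rewrite addr_gt0 // (lt_le_trans L_gt0) // LPhi_ge.
pose h := - (M^-1 *: d).
have ub := Phi_descent x h.
have := smooth_lb L_gt0 f_diff f_lip (x, y) (h, 0).
rewrite /nsq2 /= dot0r nsq0 !addr0 => lb.
have := le_trans lb (le_Phi (x + h) (y + 0)) => {}lb.
have dE : dot (grad Phi x) h - dot (grad1 f (x, y)) h = - (M^-1 * nsq d).
  by rewrite -dotBl /h dotNr dotZr.
have hE : nsq h = M^-1 ^+ 2 * nsq d by rewrite /h nsqN nsqZ.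
have e : LPhi / 2 * nsq h + L / 2 * nsq h = M^-1 * nsq d / 2.
  by rewrite hE -mulrDl -mulrDl -/M; field; rewrite gt_eqF.
have : M^-1 * nsq d <= 2 * (Phi x - f (x, y)) by lra.
by rewrite ler_pdivrMl // mulrCA mulrA.
Qed.

(** A gradient step of length [1 / LPhi] from [x] would go below the minimum of
    [Phi] if [mu1] exceeded [LPhi]; a constant [Phi] gives no such bound. *)
Lemma mu1_le_LPhi (mu1 Phimin : R) x :
  (forall x', Phimin <= Phi x') ->
  (forall x', 2 * mu1 * (Phi x' - Phimin) <= nsq (grad Phi x')) ->
  Phimin < Phi x -> mu1 <= LPhi.
Proof.
move=> Pmin PL1 lt.
have M0 : 0 < LPhi by rewrite (lt_le_trans L_gt0) // LPhi_ge.
have := le_trans (Pmin _) (Phi_descent x (- (LPhi^-1 *: grad Phi x))).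
rewrite dotNr nsqN nsqZ dotZr -/(nsq _) => le.
have e : LPhi / 2 * (LPhi^-1 ^+ 2 * nsq (grad Phi x)) =
  LPhi^-1 * nsq (grad Phi x) / 2 by field; rewrite gt_eqF.
have : LPhi^-1 * nsq (grad Phi x) <= 2 * (Phi x - Phimin) by lra.
rewrite ler_pdivrMl // => /(le_trans (PL1 x)).
by rewrite [LPhi * _]mulrCA -mulrA ler_pM2l // ler_pM2r // subr_gt0.
Qed.

End PartialMax.

(** * Sampling without replacement *)

Section Expectation.
Context {R : realType} {T : finType}.
Implicit Types (g h : T -> R).

Lemma expect_le g h : (forall t, g t <= h t) ->
  expect_unif g <= expect_unif h.
Proof.
by move=> gh; rewrite ler_wpM2r ?invr_ge0 // ler_sum // => t _; exact: gh.
Qed.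

Lemma expectD g h :
  expect_unif (fun t => g t + h t) = expect_unif g + expect_unif h.
Proof. by rewrite /expect_unif big_split mulrDl. Qed.

Lemma expectZ a g : expect_unif (fun t => a * g t) = a * expect_unif g.
Proof. by rewrite /expect_unif -mulr_sumr mulrA. Qed.

Lemma expect_sum (I : Type) (r : seq I) (P : pred I) (F : I -> T -> R) :
  expect_unif (fun t => \sum_(i <- r | P i) F i t) =
  \sum_(i <- r | P i) expect_unif (F i).
Proof. by rewrite /expect_unif exchange_big mulr_suml. Qed.

Lemma expect_cst (t0 : T) (c : R) : expect_unif (fun _ : T => c) = c.
Proof.
rewrite /expect_unif sumr_const -[c *+ _]mulr_natl mulrC mulKf //.
by rewrite pnatr_eq0 -lt0n; apply/card_gt0P; exists t0.
Qed.

Lemma expect_reindex (s : T -> T) g : injective s ->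
  expect_unif (fun t => g (s t)) = expect_unif g.
Proof. by move=> inj; rewrite /expect_unif [in RHS](reindex_inj inj). Qed.

End Expectation.

Section Reshuffling.
Context {R : realType} {n d : nat}.
Implicit Types (j k : 'I_n) (J : {set 'I_n}) (v w : 'I_n -> 'rV[R]_d).
Local Notation E := (@expect_unif R 'S_n).

(** Precomposing with a transposition exchanges two draws and preserves the
    uniform law: this is the exchangeability used below. *)
Lemma expect_perm_transfer (F : 'S_n -> R) j k :
  E (fun s => F (tperm j k * s)%g) = E F.
Proof. by apply: expect_reindex; exact: mulgI. Qed.

Lemma expect_perm1 (F : 'I_n -> R) j :
  E (fun s => F (s j)) = n%:R^-1 * \sum_p F p.
Proof.
have n0 : n%:R != 0 :> R.
  by rewrite pnatr_eq0 -lt0n; apply: leq_ltn_trans (ltn_ord j).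
apply: (mulfI n0); rewrite mulVKf //.
have -> : \sum_p F p = E (fun s => \sum_k F (s k)).
  rewrite -[LHS](expect_cst (1%g : 'S_n)); congr (expect_unif _).
  by apply/funext => s; rewrite (reindex_inj (@perm_inj _ s)).
rewrite expect_sum (eq_bigr (fun _ => E (fun s => F (s j)))); last first.
  move=> k _; rewrite -(expect_perm_transfer _ j k); congr (expect_unif _).
  by apply/funext => s; rewrite permM tpermR.
by rewrite sumr_const card_ord mulr_natl.
Qed.

(** Two distinct draws without replacement from a centered family are
    negatively correlated: by exchangeability all draws [k != j] correlate
    equally with draw [j], and together with draw [j] itself they sum to the
    correlation with the zero total. *)
Lemma expect_perm2_le0 w j k : \sum_p w p = 0 -> j != k ->
  E (fun s => dot (w (s j)) (w (s k))) <= 0.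
Proof.
move=> w0 jk; pose c k' := E (fun s => dot (w (s j)) (w (s k'))).
have cE k' : j != k' -> c k' = c k.
  move=> jk'; rewrite /c -(expect_perm_transfer _ k k'); congr (expect_unif _).
  apply/funext => s; rewrite !permM tpermR tpermD //; first by rewrite eq_sym.
  by rewrite eq_sym.
have : \sum_k' c k' = 0.
  rewrite -expect_sum -[RHS](expect_cst (1%g : 'S_n)); congr (expect_unif _).
  apply/funext => s; rewrite -dot_sumr.
  have -> : \sum_k' w (s k') = \sum_p w p.
    by rewrite [RHS](reindex_inj (@perm_inj _ s)).
  by rewrite w0 dot0r.
rewrite (bigD1 j) //= (eq_bigr (fun _ => c k)); last first.
  by move=> k' k'j; apply: cE; rewrite eq_sym.
rewrite sumr_const => sum0.
have cj : 0 <= c j.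
  rewrite -(expect_cst (1%g : 'S_n) 0); apply: expect_le => s.
  exact: nsq_ge0.
have : c k *+ #|[pred i | i != j]| <= 0 by lra.
rewrite pmulrn_lle0 => [//|]; apply/card_gt0P; exists k.
by rewrite inE eq_sym.
Qed.

Lemma expect_nsq_centered w J : \sum_p w p = 0 ->
  E (fun s => nsq (\sum_(j in J) w (s j)))
    <= #|J|%:R * (n%:R^-1 * \sum_p nsq (w p)).
Proof.
move=> w0.
have -> : (fun s : 'S_n => nsq (\sum_(j in J) w (s j))) =
  fun s => \sum_(j in J) \sum_(k in J) dot (w (s j)) (w (s k)).
  apply/funext => s; rewrite /nsq dot_suml; apply: eq_bigr => j _.
  by rewrite dot_sumr.
rewrite expect_sum mulr_natl -sumr_const; apply: ler_sum => j jJ.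
rewrite expect_sum (bigD1 j) //= -(expect_perm1 (fun p => nsq (w p)) j).
rewrite gerDl; apply: sumr_le0 => k /andP[_ kj].
by apply: expect_perm2_le0; rewrite // eq_sym.
Qed.

(** Bias-variance split of a partial sum around the mean [g]; the cross term
    vanishes because each draw is uniform. *)
Lemma expect_nsq_partial_sum v g J : (0 < n)%N ->
  n%:R^-1 *: \sum_p v p = g ->
  E (fun s => nsq (\sum_(j in J) v (s j)))
    <= #|J|%:R ^+ 2 * nsq g
       + #|J|%:R * (n%:R^-1 * \sum_p nsq (v p - g)).
Proof.
move=> n_gt0 gE; pose w p := v p - g.
have n0 : n%:R != 0 :> R by rewrite pnatr_eq0 -lt0n.
have w0 : \sum_p w p = 0.
  rewrite /w sumrB sumr_const card_ord -gE -scaler_nat scalerA mulfV //.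
  by rewrite scale1r subrr.
have -> : (fun s : 'S_n => nsq (\sum_(j in J) v (s j))) =
  fun s => #|J|%:R ^+ 2 * nsq g + 2 * #|J|%:R * \sum_(j in J) dot g (w (s j))
           + nsq (\sum_(j in J) w (s j)).
  apply/funext => s.
  have -> : \sum_(j in J) v (s j) = #|J|%:R *: g + \sum_(j in J) w (s j).
    by rewrite /w sumrB sumr_const scaler_nat addrC subrK.
  by rewrite nsqD nsqZ dotZl dot_sumr mulrA.
rewrite !expectD (expect_cst (1%g : 'S_n)) expectZ expect_sum big1 => [|j _].
  by rewrite mulr0 addr0 lerD2l; exact: expect_nsq_centered.
by rewrite (expect_perm1 (fun p => dot g (w p))) -dot_sumr w0 dot0r mulr0.
Qed.

End Reshuffling.

(** * Drift inside an epoch *)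

Section Epoch.
Context {R : realType} {n dx dy : nat}.
Local Notation Z := ('rV[R]_dx * 'rV[R]_dy)%type.
Context (fs : 'I_n -> Z -> R) (L alpha beta : R) (v : sgda_variant).
Hypothesis n_gt0 : (0 < n)%N.
Hypothesis fs_lip : forall i (z w : Z),
  nsq (grad1 (fs i) z - grad1 (fs i) w) + nsq (grad2 (fs i) z - grad2 (fs i) w)
    <= L ^+ 2 * nsq2 (z - w).

Definition prefix (i : nat) : {set 'I_n} :=
  finset (fun j : 'I_n => (j < i)%N).

Lemma sum_prefix_all (V : zmodType) (F : 'I_n -> V) :
  \sum_(j in prefix n) F j = \sum_j F j.
Proof. by apply: eq_bigl => j; rewrite inE ltn_ord. Qed.

Lemma sum_prefixS (V : zmodType) (F : 'I_n -> V) (i : 'I_n) :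
  \sum_(j in prefix i.+1) F j = \sum_(j in prefix i) F j + F i.
Proof.
rewrite (bigD1 i) /=; last by rewrite inE.
rewrite addrC; congr (_ + _); apply: eq_bigl => j.
by rewrite !inE ltnS ltn_neqAle andbC.
Qed.

Lemma sum_prefix0 (V : zmodType) (F : 'I_n -> V) :
  \sum_(j in prefix 0) F j = 0.
Proof. by rewrite big1 // => j; rewrite inE. Qed.

Lemma card_prefix_le i : (#|prefix i| <= n)%N.
Proof. by apply: leq_trans (max_card _) _; rewrite card_ord. Qed.

Section Trajectory.
Context (z0 : Z) (s : 'S_n).

Definition traj (i : nat) : Z :=
  foldl (fun w j => sgda_step v alpha beta (fs (s j)) w) z0
    (take i (enum 'I_n)).

Lemma trajS (j : 'I_n) :
  traj j.+1 = sgda_step v alpha beta (fs (s j)) (traj j).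
Proof.
by rewrite /traj (take_nth j) ?size_enum_ord // nth_ord_enum foldl_rcons.
Qed.

Lemma traj_end : traj n = sgda_epoch v alpha beta fs z0 s.
Proof. by rewrite /traj take_oversize // size_enum_ord. Qed.

(** The point at which step [j] evaluates the [y]-gradient: its [x]-block is the
    only difference between the two variants. *)
Definition eval2 (j : nat) : Z :=
  (match v with simSGDA => (traj j).1 | altSGDA => (traj j.+1).1 end,
   (traj j).2).

(* Component gradients at the start of the epoch, and their change at the points
   where the algorithm evaluates them. *)
Let p0 (j : 'I_n) := grad1 (fs (s j)) z0.
Let q0 (j : 'I_n) := grad2 (fs (s j)) z0.
Let dp (j : 'I_n) := grad1 (fs (s j)) (traj j) - p0 j.
Let dq (j : 'I_n) := grad2 (fs (s j)) (eval2 j) - q0 j.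

Lemma traj_sum (i : nat) : (i <= n)%N ->
  (traj i).1 = z0.1 - alpha *: \sum_(j in prefix i) (p0 j + dp j) /\
  (traj i).2 = z0.2 + beta *: \sum_(j in prefix i) (q0 j + dq j).
Proof.
elim: i => [_|i IH iltn].
  by rewrite !sum_prefix0 !scaler0 subr0 addr0 /traj take0.
have [IH1 IH2] := IH (ltnW iltn); pose k := Ordinal iltn.
have tS : traj i.+1 = _ := trajS k.
have sS d (F : 'I_n -> 'rV[R]_d) :
  \sum_(j in prefix i.+1) F j = _ := sum_prefixS F k.
have pk : p0 k + dp k = grad1 (fs (s k)) (traj k) by rewrite addrC subrK.
have qk : q0 k + dq k = grad2 (fs (s k)) (eval2 k) by rewrite addrC subrK.
rewrite !sS pk qk !(scalerDr _ (\sum_(j in _) _)) opprD !addrA -IH1 -IH2.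
by rewrite /eval2 [traj k.+1]tS /sgda_step /=; case: v.
Qed.

Let X (i : nat) := nsq ((traj i).1 - z0.1).
Let Y (i : nat) := nsq ((traj i).2 - z0.2).

(** The end point [i = n] is included because the alternating variant evaluates
    its last [y]-gradient at the last [x]-iterate. *)
Definition drift : R := \sum_(i < n.+1) (X i + Y i).

Let XY_ge0 i : 0 <= X i + Y i.
Proof. by rewrite addr_ge0 ?nsq_ge0. Qed.

Lemma drift_init_le : \sum_(j < n) (X j + Y j) <= drift.
Proof. by rewrite /drift big_ord_recr /= lerDl XY_ge0. Qed.

Lemma drift_shiftE : drift = \sum_(j < n) (X j.+1 + Y j.+1).
Proof.
rewrite /drift big_ord_recl /= [X in X + _](_ : _ = 0) ?add0r //.
by rewrite /X /Y /traj take0 /= !subrr !nsq0 addr0.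
Qed.

Lemma sum_dp_le : \sum_j nsq (dp j) <= L ^+ 2 * drift.
Proof.
apply: le_trans (ler_wpM2l (sqr_ge0 _) drift_init_le).
rewrite mulr_sumr; apply: ler_sum => j _.
by apply: le_trans (fs_lip (s j) (traj j) z0); rewrite lerDl nsq_ge0.
Qed.

Lemma sum_dq_le : \sum_j nsq (dq j) <= L ^+ 2 * drift.
Proof.
have le : \sum_(j < n) nsq2 (eval2 j - z0) <= drift.
  rewrite /eval2 /nsq2 /=; case: v => /=; first exact: drift_init_le.
  rewrite /drift [X in _ <= X]big_split big_split /=; apply: lerD.
    by rewrite big_ord_recl /= lerDr nsq_ge0.
  by rewrite big_ord_recr /= lerDl nsq_ge0.
apply: le_trans (ler_wpM2l (sqr_ge0 _) le).
rewrite mulr_sumr; apply: ler_sum => j _.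
by apply: le_trans (fs_lip (s j) (eval2 j) z0); rewrite lerDr nsq_ge0.
Qed.

Lemma nsq_sum_prefix_le d (F : 'I_n -> 'rV[R]_d) (i : nat) :
  nsq (\sum_(j in prefix i) F j) <= n%:R * \sum_j nsq (F j).
Proof.
apply: le_trans (nsq_sum_le _ _) _.
have ge0 : 0 <= \sum_(j in prefix i) nsq (F j).
  by apply: sumr_ge0 => j _; exact: nsq_ge0.
apply: le_trans (_ : n%:R * \sum_(j in prefix i) nsq (F j) <= _).
  by rewrite ler_wpM2r // ler_nat card_prefix_le.
rewrite ler_wpM2l // big_mkcond /=; apply: ler_sum => j _.
by case: ifP => // _; exact: nsq_ge0.
Qed.

Definition partial_sums1 : R :=
  \sum_(i < n) nsq (\sum_(j in prefix i.+1) grad1 (fs (s j)) z0).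
Definition partial_sums2 : R :=
  \sum_(i < n) nsq (\sum_(j in prefix i.+1) grad2 (fs (s j)) z0).

(** Each iterate is displaced by the partial sum of the component gradients at
    the starting point, plus gradient changes that the Lipschitz bound controls
    by the drift itself. The factor in front of the drift on the right is small
    for small steps, so [drift_le] can absorb it. *)
Lemma drift_self_bound :
  drift <= 2 * (alpha ^+ 2 * partial_sums1 + beta ^+ 2 * partial_sums2)
           + 2 * (n%:R * L) ^+ 2 * (alpha ^+ 2 + beta ^+ 2) * drift.
Proof.
have key d (F G : 'I_n -> 'rV[R]_d) (u0 u : 'rV[R]_d) a (i : nat) :
    \sum_j nsq (G j) <= L ^+ 2 * drift ->
    u - u0 = a *: \sum_(j in prefix i) (F j + G j) ->
    nsq (u - u0) <= a ^+ 2 * (2 * nsq (\sum_(j in prefix i) F j)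
                              + 2 * (n%:R * (L ^+ 2 * drift))).
  move=> Gle ->; rewrite nsqZ big_split /=.
  apply: ler_wpM2l; first exact: sqr_ge0.
  apply: le_trans (nsqD_le2 _ _) _.
  have := le_trans (nsq_sum_prefix_le G i) (ler_wpM2l (ler0n R n) Gle); lra.
rewrite [X in X <= _]drift_shiftE.
have le (i : 'I_n) : X i.+1 + Y i.+1 <=
    2 * alpha ^+ 2 * nsq (\sum_(j in prefix i.+1) p0 j)
    + 2 * beta ^+ 2 * nsq (\sum_(j in prefix i.+1) q0 j)
    + 2 * (alpha ^+ 2 + beta ^+ 2) * (n%:R * (L ^+ 2 * drift)).
  have [e1 e2] := traj_sum (ltn_ord i).
  have := key _ p0 dp z0.1 (traj i.+1).1 (- alpha) i.+1 sum_dp_le.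
  have := key _ q0 dq z0.2 (traj i.+1).2 beta i.+1 sum_dq_le.
  rewrite e1 e2 ![_ + _ - _]addrC !addKr scaleNr sqrrN.
  move=> /(_ erefl) leY /(_ erefl) leX; rewrite /X /Y e1 e2.
  by rewrite ![_ + _ - _]addrC !addKr; lra.
apply: le_trans (ler_sum _ (fun i _ => le i)) _.
rewrite !big_split /= -!mulr_sumr -/partial_sums1 -/partial_sums2.
by rewrite sumr_const card_ord -(mulr_natl drift) exprMn; lra.
Qed.

Lemma drift_le : 2 * (n%:R * L) ^+ 2 * (alpha ^+ 2 + beta ^+ 2) <= 17^-1 ->
  drift <= 17 / 8 * (alpha ^+ 2 * partial_sums1 + beta ^+ 2 * partial_sums2).
Proof.
have d0 : 0 <= drift by apply: sumr_ge0 => i _; exact: XY_ge0.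
move=> /(ler_wpM2r d0); have := drift_self_bound; lra.
Qed.

(** An epoch is one full-gradient step of length [n * alpha], [n * beta] whose
    gradients are off by the average deviation along the trajectory. *)
Lemma epoch_as_inexact_step : exists e1 e2,
  [/\ sgda_epoch v alpha beta fs z0 s =
        (z0.1 - (n%:R * alpha) *: (n%:R^-1 *: \sum_i grad1 (fs i) z0 + e1),
         z0.2 + (n%:R * beta) *: (n%:R^-1 *: \sum_i grad2 (fs i) z0 + e2)),
      nsq e1 <= L ^+ 2 / n%:R * drift & nsq e2 <= L ^+ 2 / n%:R * drift].
Proof.
have n0 : n%:R != 0 :> R by rewrite pnatr_eq0 -lt0n.
exists (n%:R^-1 *: \sum_j dp j), (n%:R^-1 *: \sum_j dq j); split.
- have sc a d (u : 'rV[R]_d) : (n%:R * a) *: (n%:R^-1 *: u) = a *: u.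
    by rewrite scalerA mulrAC mulfV // mul1r.
  have sE d (F : 'I_n -> 'rV[R]_d) : \sum_i F i = \sum_j F (s j).
    by rewrite (reindex_inj (@perm_inj _ s)).
  have [e1 e2] := traj_sum (leqnn n).
  rewrite -traj_end [LHS]surjective_pairing e1 e2 !sum_prefix_all !big_split /=.
  rewrite -!scalerDr !sc (sE _ (fun i => grad1 (fs i) z0)).
  by rewrite (sE _ (fun i => grad2 (fs i) z0)).
- apply: le_trans (nsq_mean_le _ n_gt0) _.
  by rewrite [L ^+ 2 / _]mulrC -mulrA ler_pM2l ?invr_gt0 ?ltr0n // sum_dp_le.
- apply: le_trans (nsq_mean_le _ n_gt0) _.
  by rewrite [L ^+ 2 / _]mulrC -mulrA ler_pM2l ?invr_gt0 ?ltr0n // sum_dq_le.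
Qed.

End Trajectory.

Lemma expect_partial_sums (d : nat) (F : 'I_n -> 'rV[R]_d) (W : R) :
  n%:R^-1 * \sum_p nsq (F p - n%:R^-1 *: \sum_i F i) <= W ->
  expect_unif (fun s : 'S_n =>
      \sum_(i < n) nsq (\sum_(j in prefix i.+1) F (s j)))
    <= n%:R ^+ 3 * (nsq (n%:R^-1 *: \sum_i F i) + W / n%:R).
Proof.
set g := _ *: _ => leW; rewrite expect_sum.
have n0 : n%:R != 0 :> R by rewrite pnatr_eq0 -lt0n.
have W0 : 0 <= W.
  apply: le_trans leW; rewrite mulr_ge0 ?invr_ge0 // sumr_ge0 // => p _.
  exact: nsq_ge0.
have -> : n%:R ^+ 3 * (nsq g + W / n%:R) =
    \sum_(i < n) (n%:R ^+ 2 * nsq g + n%:R * W).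
  by rewrite sumr_const card_ord -[RHS]mulr_natl; field.
apply: ler_sum => i _.
apply: le_trans (expect_nsq_partial_sum _ n_gt0 (erefl g)) _.
have cle : #|prefix i.+1|%:R <= n%:R :> R by rewrite ler_nat card_prefix_le.
apply: lerD; first by rewrite ler_wpM2r ?nsq_ge0 // lerXn2r // nnegrE.
apply: (le_trans (ler_wpM2l _ leW)) => //.
by rewrite ler_wpM2r.
Qed.

End Epoch.

(** * One epoch decreases the potential *)

Section Average.
Context {R : realType} {n dx dy : nat}.
Local Notation Z := ('rV[R]_dx * 'rV[R]_dy)%type.
Context (fs : 'I_n -> Z -> R).
Hypothesis fs_diff : forall i z, differentiable (fs i) z.

Lemma favgE : favg fs = n%:R^-1 *: \sum_i fs i.
Proof. by apply/funext => z; rewrite /favg fctE fct_sumE. Qed.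

Lemma favg_diff z : differentiable (favg fs) z.
Proof.
by rewrite favgE; apply: differentiableZ; apply: differentiable_sum.
Qed.

Lemma derive_favg z (h : Z) :
  'D_h (favg fs) z = n%:R^-1 * \sum_i 'D_h (fs i) z.
Proof.
have dfs i : derivable (fs i) z h by exact: diff_derivable.
by rewrite favgE deriveZ ?derive_sum //; exact: derivable_sum.
Qed.

Lemma grad1_favg z : grad1 (favg fs) z = n%:R^-1 *: \sum_i grad1 (fs i) z.
Proof.
apply/rowP => k; rewrite grad1E derive_favg mxE summxE; congr (_ * _).
by apply: eq_bigr => i _; rewrite grad1E.
Qed.

Lemma grad2_favg z : grad2 (favg fs) z = n%:R^-1 *: \sum_i grad2 (fs i) z.
Proof.
apply/rowP => k; rewrite grad2E derive_favg mxE summxE; congr (_ * _).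
by apply: eq_bigr => i _; rewrite grad2E.
Qed.

Lemma favg_lip (L : R) : (0 < n)%N ->
  (forall i (z w : Z),
    nsq (grad1 (fs i) z - grad1 (fs i) w)
    + nsq (grad2 (fs i) z - grad2 (fs i) w) <= L ^+ 2 * nsq2 (z - w)) ->
  forall z w : Z,
    nsq (grad1 (favg fs) z - grad1 (favg fs) w)
    + nsq (grad2 (favg fs) z - grad2 (favg fs) w) <= L ^+ 2 * nsq2 (z - w).
Proof.
move=> n0 lip z w; rewrite !grad1_favg !grad2_favg -!scalerBr -!sumrB.
apply: le_trans (lerD (nsq_mean_le _ n0) (nsq_mean_le _ n0)) _.
rewrite -mulrDr -big_split /= ler_pdivrMl ?ltr0n // mulr_natl.
rewrite -[X in _ *+ X]card_ord -sumr_const; apply: ler_sum => i _; exact: lip.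
Qed.

End Average.

Section PotentialStep.
Context {R : realType}.

(** With [u = G - d + e] the inexact [x]-gradient, this collects the first-order
    decrease of [5 * Phi] and the first-order increase of [- f]; completing
    squares leaves a multiple of [|G|^2] as net gain. The coefficient of [|G|^2]
    exceeds [1], the amount the contraction needs, to leave room for the drift;
    that of [|d|^2] must stay below about [14 / 3] times what [y_block_bound]
    gains; and [11 / 168 = 5 / 84 + 1 / 168] is the second-order cost for
    [a * LPhi <= 1 / 42] and [a * L <= 1 / 84]. *)
Lemma x_block_bound m (G d e : 'rV[R]_m) :
  51 / 50 * nsq G + 11 / 168 * nsq (G - d + e) + dot (G - d) (G - d + e)
    <= 5 * dot G (G - d + e) + 11 / 5 * nsq d + 10 * nsq e.
Proof.
(* A numerical sum-of-squares certificate: the first square is close to the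
   minimizing direction of [G], the others dominate what remains. *)
have h1 := nsq_ge0 (2 *: G - d + (7 / 5) *: e).
have h2 := nsq_ge0 (G - d).
have h3 := nsq_ge0 (d + 4 *: e).
have h4 := nsq_ge0 (G - e).
have h5 := nsq_ge0 G; have h6 := nsq_ge0 d; have h7 := nsq_ge0 e.
move: h1 h2 h3 h4; rewrite !nsqD !nsqN !nsqZ !dotDl !dotDr !dotNl !dotNr !dotZl
  !dotZr -!/(nsq _) ?(dotC d G) ?(dotC e G) ?(dotC e d).
by lra.
Qed.

Lemma y_block_bound m (g e : 'rV[R]_m) :
  7 / 10 * nsq g + nsq (g + e) / 12 <= dot g (g + e) + nsq e.
Proof.
have h1 := nsq_ge0 (g + 2 *: e); have h5 := nsq_ge0 g; have h7 := nsq_ge0 e.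
by move: h1; rewrite !nsqD !nsqZ !dotDr !dotZr -!/(nsq _); lra.
Qed.

Context {dx dy : nat}.
Local Notation Z := ('rV[R]_dx * 'rV[R]_dy)%type.
Context (L mu2 : R) (f : Z -> R) (Phi : 'rV[R]_dx -> R) (Phimin : R).
Hypothesis L_gt0 : 0 < L.
Hypothesis f_diff : forall z, differentiable f z.
Hypothesis f_lip : forall z w : Z,
  nsq (grad1 f z - grad1 f w) + nsq (grad2 f z - grad2 f w)
    <= L ^+ 2 * nsq2 (z - w).
Hypothesis Phi_max : forall x, is_max (range (fun y => f (x, y))) (Phi x).
Hypothesis mu2_gt0 : 0 < mu2.
Hypothesis PL2 : forall x y,
  2 * mu2 * (Phi x - f (x, y)) <= nsq (grad2 f (x, y)).

(** The step contributes [- 5 a <G, u>] through [Phi] and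
    [a <g1, u> - b <g2, w>] through [- f], where [u] and [w] are the inexact
    gradients; the two block bounds then apply separately. *)
Lemma potential_step (z : Z) (a b : R) e1 e2 :
  0 <= a -> 0 <= b ->
  a * LPhi L mu2 <= 42^-1 -> a * L <= 84^-1 -> b * L <= 6^-1 ->
  let g1 := grad1 f z in let g2 := grad2 f z in let G := grad Phi z.1 in
  potential 4 f Phi Phimin
    (z.1 - a *: (g1 + e1), z.2 + b *: (g2 + e2))
  <= potential 4 f Phi Phimin z
     + a * (11 / 5 * nsq (G - g1) + 10 * nsq e1 - 51 / 50 * nsq G)
     + b * (nsq e2 - 7 / 10 * nsq g2).
Proof.
move=> a0 b0 aM aL bL; cbv zeta.
set g1 := grad1 f z; set g2 := grad2 f z; set G := grad Phi z.1.
have PhiU := Phi_descent L_gt0 f_diff f_lip Phi_max mu2_gt0 PL2 z.1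
  (- (a *: (g1 + e1))).
have fL := smooth_lb L_gt0 f_diff f_lip z (- (a *: (g1 + e1)), b *: (g2 + e2)).
move: PhiU fL; rewrite /nsq2 /= !dotNr !nsqN !nsqZ !dotZr -/g1 -/g2 -/G.
set x1 := z.1 - _; set y1 := z.2 + _.
have -> : z + (- (a *: (g1 + e1)), b *: (g2 + e2)) = (x1, y1) by [].
move=> PhiU fL; rewrite /potential /=.
have := x_block_bound G (G - g1) e1; rewrite subKr => xb.
have yb := y_block_bound g2 e2.
have u0 := nsq_ge0 (g1 + e1); have w0 := nsq_ge0 (g2 + e2).
have := ler_wpM2l a0 xb; have := ler_wpM2l b0 yb.
have := ler_wpM2r (mulr_ge0 a0 u0) aM.
have := ler_wpM2r (mulr_ge0 a0 u0) aL.
have := ler_wpM2r (mulr_ge0 b0 w0) bL.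
lra.
Qed.

End PotentialStep.

(** The bookkeeping of one epoch. With [q = L / mu2], the gradient error costs
    [a * dd <= 3 * a * q^2 * gg2], which is why [a] must be smaller than [b] by
    a factor of order [q^2]; the trajectory error [ED] is a small multiple of
    the squared gradients plus the noise floor. Here [GG], [gg1], [gg2] and [dd]
    stand for the squared norms of [grad Phi], [grad1 f], [grad2 f] and
    [grad Phi - grad1 f], and [gap1], [gap2] for [Phi - Phimin] and
    [Phi - f]. *)
Lemma contraction_arith (R : realFieldType)
    (a b r L M mu1 mu2 t Bn GG gg1 gg2 dd gap1 gap2 ED V1 : R) :
  0 < mu2 -> mu2 <= L -> M = L + L ^+ 2 / mu2 -> mu1 <= M ->
  14 * (L / mu2) ^+ 2 <= r -> a * r = b -> 0 <= b ->
  (L * b) ^+ 2 * t <= 36^-1 -> 0 <= t -> 0 <= Bn ->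
  0 <= GG -> 0 <= gg1 -> 0 <= gg2 -> 0 <= dd -> 0 <= gap2 -> 0 <= ED ->
  gg1 <= 2 * GG + 2 * dd ->
  dd <= 2 * (M + L) * gap2 ->
  2 * mu2 * gap2 <= gg2 ->
  2 * mu1 * gap1 <= GG ->
  ED <= 17 / 8 *
    (L ^+ 2 * (a ^+ 2 * (t * gg1 + Bn) + b ^+ 2 * (t * gg2 + Bn))) ->
  V1 <= 4 * gap1 + gap2 + a * (11 / 5 * dd + 10 * ED - 51 / 50 * GG)
        + b * (ED - 7 / 10 * gg2) ->
  V1 <= (1 - a * mu1 / 2) * (4 * gap1 + gap2)
        + 37 / 10 * (L ^+ 2 * b ^+ 3 * Bn).
Proof.
move=> m0 mL ME m1M qr abE b0 sm t0 Bn0 GG0 gg10 gg20 dd0 gap20 ED0 g1le ddle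
  pl2 pl1 EDle Vle.
set q := L / mu2 in qr.
have LE : L = q * mu2 by rewrite /q divfK // gt_eqF.
have L0 : 0 <= L by lra.
have q1 : 1 <= q by rewrite /q ler_pdivlMr // mul1r.
have q21 : 1 <= q ^+ 2 by rewrite expr_ge1 // (le_trans ler01).
have r14 : 14 <= r by lra.
have a0 : 0 <= a by rewrite -(pmulr_lge0 _ (_ : 0 < r)) ?abE //; lra.
have MLq : M = L + L * q by rewrite ME /q expr2 mulrA.
have aq : 14 * (a * q ^+ 2) <= b.
  by rewrite -abE mulrCA ler_wpM2l.
have ab : 14 * a <= b.
  by rewrite -abE mulrC ler_wpM2l.
have Lq : L <= L * q by rewrite ler_peMr //; lra.
have ddle2 : dd <= 3 * (q ^+ 2 * gg2).
  have h1 : 2 * (M + L) * gap2 <= 6 * (L * q) * gap2.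
    by rewrite ler_wpM2r //; lra.
  have h2 : q ^+ 2 * (2 * mu2 * gap2) <= q ^+ 2 * gg2.
    by rewrite ler_wpM2l // sqr_ge0.
  have h3 : 6 * (L * q) * gap2 = 3 * (q ^+ 2 * (2 * mu2 * gap2)).
    by rewrite {1}LE; ring.
  lra.
have add : a * dd <= 3 / 14 * (b * gg2).
  have h1 := ler_wpM2l a0 ddle2.
  have h2 := ler_wpM2r gg20 aq.
  lra.
have mugap : a * mu1 * gap2 <= (b * gg2) / 14.
  have h1 : a * mu1 * gap2 <= a * (2 * (L * q)) * gap2.
    by rewrite ler_wpM2r // ler_wpM2l //; lra.
  have h2 : a * (2 * (L * q)) * gap2 = (a * q ^+ 2) * (2 * mu2 * gap2).
    by rewrite {1}LE; ring.
  have h3 : (a * q ^+ 2) * (2 * mu2 * gap2) <= (a * q ^+ 2) * gg2.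
    by rewrite ler_wpM2l // mulr_ge0 ?sqr_ge0.
  have h4 := ler_wpM2r gg20 aq.
  lra.
have aGG := ler_wpM2l a0 pl1.
have ag1 := ler_wpM2l a0 g1le.
have aED := ler_wpM2r ED0 ab.
have bED := ler_wpM2l b0 EDle.
(* The step bound [sm] turns the relative part of [b * ED] into a fraction of
   [b * gg2] and, since [a <= b / 14], of [a * gg1]. *)
have E2 : b * (L ^+ 2 * (b ^+ 2 * (t * gg2))) <= 36^-1 * (b * gg2).
  have -> : b * (L ^+ 2 * (b ^+ 2 * (t * gg2))) = (L * b) ^+ 2 * t * (b * gg2).
    by ring.
  by rewrite ler_wpM2r // mulr_ge0.
have E1 : b * (L ^+ 2 * (a ^+ 2 * (t * gg1))) <= 36^-1 * (a * gg1) / 14.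
  have h1 : 14 * (b * (L ^+ 2 * (a ^+ 2 * (t * gg1)))) <=
      b * (b * (L ^+ 2 * (a * (t * gg1)))).
    have -> : 14 * (b * (L ^+ 2 * (a ^+ 2 * (t * gg1)))) =
        14 * a * (b * (L ^+ 2 * (a * (t * gg1)))) by ring.
    by rewrite ler_wpM2r // !mulr_ge0 ?sqr_ge0.
  have h2 : b * (b * (L ^+ 2 * (a * (t * gg1)))) <= 36^-1 * (a * gg1).
    have -> : b * (b * (L ^+ 2 * (a * (t * gg1)))) =
        (L * b) ^+ 2 * t * (a * gg1) by ring.
    by rewrite ler_wpM2r // mulr_ge0.
  lra.
have EB : b * (L ^+ 2 * (a ^+ 2 * Bn)) <= (L ^+ 2 * b ^+ 3 * Bn) / 196.
  have h1 : (14 * a) ^+ 2 <= b ^+ 2 by rewrite lerXn2r // nnegrE; lra.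
  have h2 : (14 * a) ^+ 2 * (b * (L ^+ 2 * Bn)) <= b ^+ 2 * (b * (L ^+ 2 * Bn)).
    by rewrite ler_wpM2r // !mulr_ge0 ?sqr_ge0.
  have -> : L ^+ 2 * b ^+ 3 * Bn = b ^+ 2 * (b * (L ^+ 2 * Bn)) by ring.
  have h3 : (14 * a) ^+ 2 * (b * (L ^+ 2 * Bn)) =
    196 * (b * (L ^+ 2 * (a ^+ 2 * Bn))) by ring.
  lra.
have B0 : 0 <= L ^+ 2 * b ^+ 3 * Bn.
  by rewrite !mulr_ge0 ?sqr_ge0 ?exprn_ge0.
have bgg2 : 0 <= b * gg2 by rewrite mulr_ge0.
have aGG0 : 0 <= a * GG by rewrite mulr_ge0.
have bEDle : b * ED <= 17 / 8 * (36^-1 * (b * gg2) + 36^-1 * (a * gg1) / 14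
    + (1 + 196^-1) * (L ^+ 2 * b ^+ 3 * Bn)) by lra.
lra.
Qed.

Section ExpectedEpoch.
Context {R : realType} {n dx dy : nat}.
Local Notation Z := ('rV[R]_dx * 'rV[R]_dy)%type.
Context (fs : 'I_n -> Z -> R) (L A B mu1 mu2 r beta Phimin : R)
  (Phi : 'rV[R]_dx -> R) (v : sgda_variant).
Let f := favg fs.
Let M := LPhi L mu2.
Let alpha := beta / r.
Hypothesis n_gt0 : (0 < n)%N.
Hypothesis L_gt0 : 0 < L.
Hypothesis fs_diff : forall i z, differentiable (fs i) z.
Hypothesis fs_lip : forall i (z w : Z),
  nsq (grad1 (fs i) z - grad1 (fs i) w) + nsq (grad2 (fs i) z - grad2 (fs i) w)
    <= L ^+ 2 * nsq2 (z - w).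
Hypothesis A_ge0 : 0 <= A.
Hypothesis B_ge0 : 0 <= B.
Hypothesis var1 : forall z,
  n%:R^-1 * (\sum_i nsq (grad1 (fs i) z - grad1 f z)) <=
    A * nsq (grad1 f z) + B.
Hypothesis var2 : forall z,
  n%:R^-1 * (\sum_i nsq (grad2 (fs i) z - grad2 f z)) <=
    A * nsq (grad2 f z) + B.
Hypothesis Phi_max : forall x, is_max (range (fun y => f (x, y))) (Phi x).
Hypothesis mu2_gt0 : 0 < mu2.
Hypothesis PL2 : forall x y,
  2 * mu2 * (Phi x - f (x, y)) <= nsq (grad2 f (x, y)).
Hypothesis PL1 : forall x, 2 * mu1 * (Phi x - Phimin) <= nsq (grad Phi x).
Hypothesis mu2L : mu2 <= L.
Hypothesis mu1M : mu1 <= M.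
Hypothesis r_ge : 14 * (L / mu2) ^+ 2 <= r.
Hypothesis beta_ge0 : 0 <= beta.
Hypothesis beta_le : (L * (n%:R * beta)) ^+ 2 * (1 + A / n%:R) <= 36^-1.

Lemma r_ge14 : 14 <= r.
Proof.
have q1 : 1 <= L / mu2 by rewrite ler_pdivlMr // mul1r.
by apply: le_trans r_ge; rewrite ler_peMr // expr_ge1 // (le_trans ler01).
Qed.

Lemma step_sizes_small a b : a * r = b -> 0 <= b ->
  (L * b) ^+ 2 * (1 + A / n%:R) <= 36^-1 ->
  [/\ b * L <= 6^-1, a * L <= 84^-1 & a * M <= 42^-1].
Proof.
move=> arb b0 sm.
have q1 : 1 <= L / mu2 by rewrite ler_pdivlMr // mul1r.
have q21 : 1 <= (L / mu2) ^+ 2 by rewrite expr_ge1 // (le_trans ler01).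
have r0 : 0 < r by apply: lt_le_trans r_ge14.
have a0 : 0 <= a by rewrite -(pmulr_lge0 _ r0) arb.
have ab : 14 * a <= b by rewrite -arb mulrC ler_wpM2l // r_ge14.
have t1 : 1 <= 1 + A / n%:R by rewrite lerDl divr_ge0.
have Lb : b * L <= 6^-1.
  rewrite mulrC -(ler_pXn2r (isT : (0 < 2)%N)) ?nnegrE ?mulr_ge0 ?(ltW L_gt0)
    ?invr_ge0 //.
  apply: (@le_trans _ _ 36^-1); last by lra.
  by apply: le_trans sm; rewrite ler_peMr ?sqr_ge0.
have La : a * L <= 84^-1 by have := ler_wpM2r (ltW L_gt0) ab; lra.
split=> //.
have h2 := ler_wpM2l (mulr_ge0 a0 (ltW L_gt0)) r_ge.
have -> : a * M = a * L * (1 + L / mu2).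
  by rewrite /M /LPhi; field; rewrite gt_eqF.
move: (L / mu2) q1 q21 h2 => q q1 q21 h2.
have h1 : a * L * (1 + q) <= a * L * (2 * q ^+ 2).
  apply: ler_wpM2l; first by rewrite mulr_ge0 // ltW.
  have : q <= q ^+ 2 by rewrite expr2 ler_peMr //; lra.
  lra.
have h3 : a * L * r = b * L by rewrite -arb; ring.
lra.
Qed.

(** The variance bounds turn the mean square of the drift into the relative part
    [1 + A / n] and the noise [B / n] that [contraction_arith] expects. *)
Lemma expect_potential_epoch z :
  expect_unif (fun s : 'S_n =>
      potential 4 f Phi Phimin (sgda_epoch v alpha beta fs z s))
  <= (1 - n%:R * alpha * mu1 / 2) * potential 4 f Phi Phimin z
     + 37 / 10 * (L ^+ 2 * (n%:R * beta) ^+ 3 * (B / n%:R)).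
Proof.
have nR : 0 < n%:R :> R by rewrite ltr0n.
have n0 : n%:R != 0 :> R by rewrite gt_eqF.
have r0 : 0 < r by apply: lt_le_trans r_ge14.
have f_diff := favg_diff fs_diff.
have f_lip := favg_lip fs_diff n_gt0 fs_lip.
set a := n%:R * alpha; set b := n%:R * beta.
have b0 : 0 <= b by rewrite mulr_ge0.
have arb : a * r = b by rewrite /a /alpha /b; field; rewrite gt_eqF.
have a0 : 0 <= a by rewrite -(pmulr_lge0 _ r0) arb.
have [Lb La aM] := step_sizes_small arb b0 beta_le.
have small : 2 * (n%:R * L) ^+ 2 * (alpha ^+ 2 + beta ^+ 2) <= 17^-1.
  have -> : 2 * (n%:R * L) ^+ 2 * (alpha ^+ 2 + beta ^+ 2) =
    2 * ((L * a) ^+ 2 + (L * b) ^+ 2) by rewrite /a /b; ring.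
  have sq_le c k : 0 <= c -> 0 <= k -> c * L <= k -> (L * c) ^+ 2 <= k ^+ 2.
    move=> c0 k0 ck; have Lc0 : 0 <= L * c by rewrite mulr_ge0 // ltW.
    by rewrite lerXn2r ?nnegrE // mulrC.
  have := sq_le a _ a0 _ La; have := sq_le b _ b0 _ Lb.
  by rewrite !invr_ge0 !ler0n => /(_ isT) hb /(_ isT) ha; lra.
set g1 := grad1 f z; set g2 := grad2 f z; set G := grad Phi z.1.
pose P1 (s : 'S_n) := partial_sums1 fs z s.
pose P2 (s : 'S_n) := partial_sums2 fs z s.
pose c := 17 / 8 * (L ^+ 2 / n%:R).
pose D (s : 'S_n) := c * alpha ^+ 2 * P1 s + c * beta ^+ 2 * P2 s.
have step s : potential 4 f Phi Phimin (sgda_epoch v alpha beta fs z s) <=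
    potential 4 f Phi Phimin z
      + a * (11 / 5 * nsq (G - g1) - 51 / 50 * nsq G) - b * (7 / 10 * nsq g2)
    + (10 * a + b) * D s.
  have [e1 [e2 [-> le1 le2]]] :=
    epoch_as_inexact_step alpha beta v n_gt0 fs_lip z s.
  rewrite -grad1_favg // -grad2_favg //.
  have dr : L ^+ 2 / n%:R * drift fs alpha beta v z s <= D s.
    have -> : D s = L ^+ 2 / n%:R *
        (17 / 8 * (alpha ^+ 2 * P1 s + beta ^+ 2 * P2 s)).
      by rewrite /D /c; ring.
    rewrite ler_wpM2l ?divr_ge0 ?sqr_ge0 //.
    exact: drift_le.
  have := potential_step Phimin L_gt0 f_diff f_lip Phi_max mu2_gt0 PL2
    z e1 e2 a0 b0 aM La Lb.
  cbv zeta; rewrite -/f -/g1 -/g2 -/G.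
  have h1 := ler_wpM2l a0 (le_trans le1 dr).
  have h2 := ler_wpM2l b0 (le_trans le2 dr).
  lra.
have EP1 : expect_unif P1 <=
    n%:R ^+ 3 * (nsq g1 + (A * nsq g1 + B) / n%:R).
  rewrite /P1 /partial_sums1 /g1 grad1_favg //.
  by apply: expect_partial_sums => //; rewrite -grad1_favg.
have EP2 : expect_unif P2 <=
    n%:R ^+ 3 * (nsq g2 + (A * nsq g2 + B) / n%:R).
  rewrite /P2 /partial_sums2 /g2 grad2_favg //.
  by apply: expect_partial_sums => //; rewrite -grad2_favg.
have c0 : 0 <= c by rewrite /c !mulr_ge0 ?invr_ge0 ?sqr_ge0 // ltW.
have ED0 : 0 <= expect_unif D.
  rewrite -(expect_cst (1%g : 'S_n) 0); apply: expect_le => s.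
  have P10 : 0 <= P1 s by apply/sumr_ge0 => i _; exact: nsq_ge0.
  have P20 : 0 <= P2 s by apply/sumr_ge0 => i _; exact: nsq_ge0.
  by rewrite addr_ge0 // mulr_ge0 // mulr_ge0 ?sqr_ge0.
have EDle : expect_unif D <= 17 / 8 * (L ^+ 2 *
   (a ^+ 2 * ((1 + A / n%:R) * nsq g1 + B / n%:R)
    + b ^+ 2 * ((1 + A / n%:R) * nsq g2 + B / n%:R))).
  rewrite expectD !expectZ.
  have h1 := ler_wpM2l (mulr_ge0 c0 (sqr_ge0 alpha)) EP1.
  have h2 := ler_wpM2l (mulr_ge0 c0 (sqr_ge0 beta)) EP2.
  apply: le_trans (lerD h1 h2) _; rewrite le_eqVlt; apply/orP; left.
  by apply/eqP; rewrite /c /a /b; field.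
have := expect_le step.
rewrite (expectD (fun=> _) (fun s => (10 * a + b) * D s)) expectZ.
rewrite (expect_cst (1%g : 'S_n)).
have VE : potential 4 f Phi Phimin z =
  4 * (Phi z.1 - Phimin) + (Phi z.1 - f z) by [].
rewrite !VE => EV.
have zE : f z = f (z.1, z.2) by case: (z).
have gap2_ge0 : 0 <= Phi z.1 - f z.
  by rewrite subr_ge0 zE; exact: le_Phi Phi_max _ _.
have g2E : g2 = grad2 f (z.1, z.2) by rewrite /g2; case: (z).
have g1E : g1 = grad1 f (z.1, z.2) by rewrite /g1; case: (z).
apply: (@contraction_arith _ a b r L M mu1 mu2 (1 + A / n%:R) (B / n%:R)
  (nsq G) (nsq g1) (nsq g2) (nsq (G - g1)) _ _ (expect_unif D)) => //;
  rewrite ?nsq_ge0 ?divr_ge0 //.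
- by rewrite addr_ge0 // divr_ge0.
- have -> : nsq g1 = nsq (G + (- (G - g1))) by rewrite subKr.
  by apply: le_trans (nsqD_le2 _ _) _; rewrite nsqN.
- by rewrite g1E zE; exact: (grad_error_le L_gt0 f_diff f_lip Phi_max mu2_gt0).
- by rewrite g2E zE; exact: PL2.
- lra.
Qed.

End ExpectedEpoch.

(** * Iteration over the epochs and choice of the step size *)

Lemma expect_tupleS (R : realType) (T : finType) (K : nat)
    (g : K.+1.-tuple T -> R) :
  expect_unif g =
  expect_unif
    (fun s => expect_unif (fun t : K.-tuple T => g [tuple of s :: t])).
Proof.
rewrite /expect_unif card_tuple expnS natrM invfM mulrA.
rewrite -[in RHS]mulr_suml card_tuple mulrAC; congr (_ / _ / _).
rewrite pair_big /=.
rewrite (reindex (fun u : T * K.-tuple T => [tuple of u.1 :: u.2])) //.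
exists (fun t : K.+1.-tuple T => (thead t, [tuple of behead t])).
  move=> [s t] _.
  by rewrite /= theadE; congr pair; apply: val_inj.
by move=> t _; rewrite /= -tuple_eta.
Qed.

(** A contraction with additive noise, iterated over independent draws; the
    noise accumulates to the geometric series [N / x]. *)
Lemma expect_iterate (R : realType) (T : finType) (X : Type) (V : X -> R)
    (F : X -> T -> X) (x N : R) : T -> 0 < x -> x <= 1 -> 0 <= N ->
  (forall z, expect_unif (fun s => V (F z s)) <= (1 - x) * V z + N) ->
  forall (K : nat) z,
  expect_unif (fun t : K.-tuple T => V (foldl F z t))
    <= (1 - x) ^+ K * V z + N / x.
Proof.
move=> s0 x0 x1 N0 step K z.
have xne : x != 0 by rewrite gt_eqF.
have rK k : 0 <= (1 - x) ^+ k by rewrite exprn_ge0 // subr_ge0.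
apply: (@le_trans _ _ ((1 - x) ^+ K * V z + N / x * (1 - (1 - x) ^+ K))).
  elim: K z => [|K IH] z.
    rewrite expr0 mul1r subrr mulr0 addr0.
    have -> : (fun t : 0.-tuple T => V (foldl F z t)) = fun=> V z.
      by apply/funext => t; rewrite tuple0.
    by rewrite (expect_cst [tuple]).
  rewrite expect_tupleS; apply: le_trans (expect_le (fun s => IH (F z s))) _.
  rewrite (expectD (fun s => (1 - x) ^+ K * V (F z s)) (fun=> _)).
  rewrite (expectZ _ (fun s => V (F z s))) (expect_cst s0).
  have := ler_wpM2l (rK K) (step z).
  have -> : (1 - x) ^+ K.+1 * V z + N / x * (1 - (1 - x) ^+ K.+1) =
    (1 - x) ^+ K * ((1 - x) * V z + N) + N / x * (1 - (1 - x) ^+ K).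
    by rewrite exprS; field.
  by move=> h; rewrite lerD2r.
rewrite lerD2l ler_piMr ?divr_ge0 ?(ltW x0) //.
by rewrite gerBl.
Qed.

(** The largest admissible step makes [L * n * beta * sqrt (1 + A / n)] equal to
    [1 / 6]. *)
Lemma epoch_max_step (R : realType) (L A : R) (n : nat) :
  (0 < n)%N -> 0 < L -> 0 <= A ->
  n%:R * (1 / (6 * L * Num.sqrt (n%:R * (n%:R + A)))) =
  (6 * L * Num.sqrt (1 + A / n%:R))^-1.
Proof.
move=> n_gt0 L0 A0; have nR : 0 < n%:R :> R by rewrite ltr0n.
have n0 : n%:R != 0 :> R by rewrite gt_eqF.
have s0 : 0 < Num.sqrt (1 + A / n%:R).
  by rewrite sqrtr_gt0 ltr_pwDl // divr_ge0 // ltW.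
have -> : n%:R * (n%:R + A) = n%:R ^+ 2 * (1 + A / n%:R) by field.
rewrite sqrtrM ?sqr_ge0 // sqrtr_sqr ger0_norm ?(ltW nR) //.
by field; rewrite n0 !gt_eqF.
Qed.

Theorem theorem2 (R : realType) :
  exists c C p : R,
  [/\ 0 < c, 0 < C & 0 < p] /\
  forall (n K dx dy : nat), (1 <= n)%N -> (1 <= K)%N ->
  forall fs : 'I_n -> 'rV[R]_dx * 'rV[R]_dy -> R,
  let f := favg fs in
  forall L : R, 0 < L ->
  (forall i z, differentiable (fs i) z) ->
  (forall i z w,
     enorm2 (grad12 (fs i) z - grad12 (fs i) w) <= L * enorm2 (z - w)) ->
  forall A B : R, 0 <= A -> 0 <= B ->
  (forall z, n%:R^-1 * (\sum_(i < n) enorm (grad1 (fs i) z - grad1 f z) ^+ 2)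
             <= A * enorm (grad1 f z) ^+ 2 + B) ->
  (forall z, n%:R^-1 * (\sum_(i < n) enorm (grad2 (fs i) z - grad2 f z) ^+ 2)
             <= A * enorm (grad2 f z) ^+ 2 + B) ->
  forall Phi : 'rV[R]_dx -> R,
  (forall x, is_max (range (fun y => f (x, y))) (Phi x)) ->
  (forall x, argmax2 f x !=set0 /\ closed (argmax2 f x)) ->
  has_lbound (range Phi) ->
  forall mu2 : R, 0 < mu2 ->
  (forall x y, 2 * mu2 * (Phi x - f (x, y)) <= enorm (grad2 f (x, y)) ^+ 2) ->
  forall Phimin : R, is_min (range Phi) Phimin ->
  forall mu1 : R, 0 < mu1 ->
  (forall x, 2 * mu1 * (Phi x - Phimin) <= enorm (grad Phi x) ^+ 2) ->
  let kappa1 := L / mu1 in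
  let kappa2 := L / mu2 in
  (* Only about the degenerate cases where f does not depend on y, resp. Phi is
     constant: there every mu2, resp. mu1, is admissible above. *)
  ((forall x y, f (x, y) = Phi x) -> 1 <= kappa2) ->
  ((forall x, Phi x = Phimin) -> 1 <= kappa1) ->
  let V := potential 4 f Phi Phimin in
  forall r : R, 14 * kappa2 ^+ 2 <= r ->
  forall z0 : 'rV[R]_dx * 'rV[R]_dy,
  let Lam := Lambda c (V z0) mu1 kappa1 r B n K in
  let beta := beta_step L A B mu1 r Lam n K in
  let alpha := beta / r in
  forall v : sgda_variant,
  expect_unif (fun s : K.-tuple 'S_n => V (sgda_rr v alpha beta fs z0 s))
    <= C * V z0 * expR (- (K%:R / (12 * kappa1 * r * Num.sqrt (1 + A / n%:R))))
       + C * (kappa1 ^+ 2 * r ^+ 3 * B / (mu1 * n%:R * K%:R ^+ 2))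
           * log_factor Lam `^ p.
Proof.
exists 1, 40, 2; split; first by split.
move=> n K dx dy n_gt0 K_gt0 fs f L L_gt0 fs_diff lip A B A_ge0 B_ge0 var1 var2
  Phi Phi_max _ _ mu2 mu2_gt0 PL2 Phimin [_ Phimin_lb] mu1 mu1_gt0 PL1
  kappa1 kappa2 deg2 deg1 V r r_ge z0 Lam beta alpha v.
have nR : 0 < n%:R :> R by rewrite ltr0n.
have KR : 0 < K%:R :> R by rewrite ltr0n.
have fs_lip i z w : nsq (grad1 (fs i) z - grad1 (fs i) w)
    + nsq (grad2 (fs i) z - grad2 (fs i) w) <= L ^+ 2 * nsq2 (z - w).
  have := lip i z w.
  rewrite -(ler_pXn2r (isT : (0 < 2)%N)) ?nnegrE ?mulr_ge0 ?sqrtr_ge0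
    ?(ltW L_gt0) //.
  by rewrite exprMn !enorm2_sqr.
have f_diff := favg_diff fs_diff.
have f_lip := favg_lip fs_diff n_gt0 fs_lip.
have {}PL2 x y : 2 * mu2 * (Phi x - f (x, y)) <= nsq (grad2 f (x, y)).
  by rewrite -enorm_sqr; exact: PL2.
have {}PL1 x : 2 * mu1 * (Phi x - Phimin) <= nsq (grad Phi x).
  by rewrite -enorm_sqr; exact: PL1.
have Pmin x : Phimin <= Phi x by apply: Phimin_lb; exists x.
have mu2L : mu2 <= L.
  have [/deg2|] := pselect (forall x y, f (x, y) = Phi x).
    by rewrite /kappa2 ler_pdivlMr // mul1r.
  move=> /existsNP[x /existsNP[y ne]].
  apply: (mu2_le_L L_gt0 f_diff f_lip Phi_max PL2 (x := x) (y := y)).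
  by rewrite lt_neqAle (introN eqP ne) le_Phi.
have mu1M : mu1 <= LPhi L mu2.
  have [/deg1|] := pselect (forall x, Phi x = Phimin).
    rewrite /kappa1 ler_pdivlMr // mul1r => /le_trans; apply.
    exact: LPhi_ge.
  move=> /existsNP[x ne].
  apply: (mu1_le_LPhi L_gt0 f_diff f_lip Phi_max mu2_gt0 PL2 Pmin PL1 (x := x)).
  by rewrite lt_neqAle Pmin andbT eq_sym (introN eqP ne).
have r14 := r_ge14 mu2_gt0 mu2L r_ge.
have r0 : 0 < r by apply: lt_le_trans r14.
have V0 : 0 <= V z0.
  rewrite /V /potential addr_ge0 // ?mulr_ge0 // subr_ge0 //.
  by case: (z0) => x y; exact: le_Phi.
set ell := log_factor Lam.
have ell1 : 1 <= ell by rewrite /ell /log_factor le_max lexx.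
pose b1 := 1 / (6 * L * Num.sqrt (n%:R * (n%:R + A))).
pose b2 := 2 * r / (mu1 * n%:R * K%:R) * ell.
have b2_gt0 : 0 < b2.
  by rewrite !mulr_gt0 ?invr_gt0 ?mulr_gt0 // (lt_le_trans _ ell1).
have betaE : beta = if B == 0 then b1 else Num.min b1 b2 by [].
set q := Num.sqrt (1 + A / n%:R).
have q2 : q ^+ 2 = 1 + A / n%:R.
  by rewrite sqr_sqrtr // addr_ge0 // divr_ge0 // ltW.
have q_gt0 : 0 < q by rewrite sqrtr_gt0 ltr_pwDl // divr_ge0 // ltW.
have nb1 : n%:R * b1 = (6 * L * q)^-1 by exact: epoch_max_step.
have b1_gt0 : 0 < b1 by rewrite -(pmulr_rgt0 _ nR) nb1 invr_gt0 !mulr_gt0.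
have beta_gt0 : 0 < beta.
  by rewrite betaE; case: ifP => // _; rewrite lt_min b1_gt0.
have beta_b1 : beta <= b1.
  by rewrite betaE; case: ifP => // _; rewrite ge_min lexx.
have beta_le : (L * (n%:R * beta)) ^+ 2 * (1 + A / n%:R) <= 36^-1.
  (* Equality holds at [beta = b1]. *)
  rewrite -q2 -exprMn.
  have -> : 36^-1 = (L * (n%:R * b1) * q) ^+ 2.
    by rewrite nb1; field; rewrite !gt_eqF.
  have le : L * (n%:R * beta) * q <= L * (n%:R * b1) * q.
    by rewrite ler_pM2r // !ler_pM2l.
  have ge0 : 0 <= L * (n%:R * beta) * q by rewrite !mulr_ge0 // ltW.
  by rewrite lerXn2r // nnegrE (le_trans ge0 le).
pose x := n%:R * alpha * mu1 / 2.
pose N := 37 / 10 * (L ^+ 2 * (n%:R * beta) ^+ 3 * (B / n%:R)).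
have a_gt0 : 0 < n%:R * alpha by rewrite mulr_gt0 // divr_gt0.
have x_gt0 : 0 < x by rewrite /x !mulr_gt0 ?invr_gt0.
have x_le1 : x <= 1.
  have arb : n%:R * alpha * r = n%:R * beta.
    by rewrite /alpha; field; rewrite gt_eqF.
  have [] := step_sizes_small L_gt0 A_ge0 mu2_gt0 mu2L r_ge arb
    (mulr_ge0 (ltW nR) (ltW beta_gt0)) beta_le.
  move=> _ _; have := ler_wpM2l (ltW a_gt0) mu1M; rewrite /x; lra.
have N_ge0 : 0 <= N.
  have nb_ge0 : 0 <= n%:R * beta by rewrite mulr_ge0 // ltW.
  rewrite mulr_ge0 // mulr_ge0 ?divr_ge0 //.
  by rewrite mulr_ge0 ?sqr_ge0 // exprn_ge0.
have step z : expect_unif (fun s : 'S_n => V (sgda_epoch v alpha beta fs z s))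
    <= (1 - x) * V z + N.
  apply: (@expect_potential_epoch _ _ _ _ fs L A B mu1 mu2) => //;
    last exact: ltW.
    by move=> w; rewrite -enorm_sqr; under eq_bigr do rewrite -enorm_sqr.
  by move=> w; rewrite -enorm_sqr; under eq_bigr do rewrite -enorm_sqr.
have main := expect_iterate (1%g : 'S_n) x_gt0 x_le1 N_ge0 step K z0.
pose Q := kappa1 ^+ 2 * r ^+ 3 * B / (mu1 * n%:R * K%:R ^+ 2).
have Q_ge0 : 0 <= Q.
  have k0 : 0 < kappa1 by exact: divr_gt0.
  have [r30 d0] : 0 <= r ^+ 3 /\ 0 <= mu1 * n%:R * K%:R ^+ 2.
    by split; rewrite ltW // ?exprn_gt0 // !mulr_gt0 // exprn_gt0.
  by rewrite divr_ge0 // mulr_ge0 // mulr_ge0 ?sqr_ge0.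
have pow : (1 - x) ^+ K <= expR (- (K%:R * x)).
  rewrite -(mulrN K%:R x) expRM_natl lerXn2r ?nnegrE ?subr_ge0 ?expR_ge0 //.
  exact: expR_ge1Dx.
(* Every noisy run has [beta <= b2], which fixes the size of the noise. *)
have noise : N / x <= 30 * Q * ell ^+ 2.
  have [B0|Bne] := eqVneq B 0.
    rewrite /N B0 mul0r !mulr0 mul0r mulr_ge0 ?sqr_ge0 //.
    by rewrite mulr_ge0.
  have bb2 : beta <= b2 by rewrite betaE (negPf Bne) ge_min lexx orbT.
  have -> : N / x = 74 / 10 * (L ^+ 2 * r * (B * n%:R) / mu1 * beta ^+ 2).
    by rewrite /N /x /alpha; field; rewrite !gt_eqF.
  have -> : 30 * Q * ell ^+ 2 =
      75 / 10 * (L ^+ 2 * r * (B * n%:R) / mu1 * b2 ^+ 2).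
    by rewrite /Q /kappa1 /b2; field; rewrite !gt_eqF.
  have c0 : 0 <= L ^+ 2 * r * (B * n%:R) / mu1.
    rewrite divr_ge0 ?(ltW mu1_gt0) // mulr_ge0 //; last by rewrite mulr_ge0.
    by rewrite mulr_ge0 ?sqr_ge0 // ltW.
  have h1 : beta ^+ 2 <= b2 ^+ 2.
    by rewrite lerXn2r // nnegrE ltW.
  have h2 := ler_wpM2l c0 h1.
  have h3 := mulr_ge0 c0 (sqr_ge0 b2).
  lra.
have ell2 : 1 <= ell ^+ 2 by rewrite expr_ge1 // (le_trans ler01).
have VKx := ler_wpM2r V0 pow.
rewrite powR_mulrn ?(le_trans ler01) // -/q -/Q.
set tgt := expR _.
have tgt0 : 0 <= tgt by exact: expR_ge0.
apply: (@le_trans _ _ ((1 - x) ^+ K * V z0 + N / x)); first exact: main.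
have QL : Q <= Q * ell ^+ 2 by rewrite ler_peMr.
have Vt0 := mulr_ge0 tgt0 V0.
(* The active term of the minimum decides how the initial potential decays. *)
have [bb1|bb1] : beta = b1 \/ (B != 0 /\ beta = b2).
- rewrite betaE; case: (eqVneq B 0) => [_|Bne]; first by left.
  by have [_|_] := leP b1 b2; [left|right].
- have e : K%:R * x = K%:R / (12 * kappa1 * r * q).
    have -> : x = n%:R * b1 * mu1 / r / 2.
      by rewrite /x /alpha bb1; field; rewrite gt_eqF.
    by rewrite nb1 /kappa1; field; rewrite !gt_eqF.
  by rewrite /tgt -e in tgt0 Vt0 *; lra.
- have [Bne be2] := bb1.
  have B_gt0 : 0 < B by rewrite lt_neqAle eq_sym Bne.
  have Q_gt0 : 0 < Q.
    by rewrite /Q /kappa1 !mulr_gt0 ?invr_gt0 ?mulr_gt0 ?exprn_gt0 ?mulr_gt0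
      ?invr_gt0.
  have Kx : K%:R * x = ell.
    by rewrite /x /alpha be2 /b2; field; rewrite !gt_eqF.
  have LamE : Lam = V z0 / (8 * Q).
    by rewrite /Lam /Lambda /Q /kappa1; field; rewrite !gt_eqF.
  (* At this step size [K] epochs contract by [exp (- ell) <= 1 / Lam], which
     brings the initial potential down to the noise floor. *)
  have floor : expR (- (K%:R * x)) * V z0 <= 8 * Q.
    move: V0; rewrite le_eqVlt => /predU1P[<-|Vgt0].
      by rewrite mulr0 mulr_ge0 // ltW.
    have Lgt0 : 0 < Lam by rewrite LamE divr_gt0 // mulr_gt0.
    have le : expR (- (K%:R * x)) <= Lam^-1.
      rewrite expRN lef_pV2 ?posrE ?expR_gt0 // -[leLHS](lnK _) ?posrE //.
      by rewrite ler_expR Kx /ell /log_factor le_max lexx orbT.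
    apply: le_trans (ler_wpM2r (ltW Vgt0) le) _.
    by rewrite LamE invf_div divfK // gt_eqF.
  lra.
Qed.
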